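(* Let $\omega_n=(s_1,\ldots,s_N)$ be a uniform $n$-element sorting network, where $N=\binom n2$. (i) The random sequence $(s_1,\ldots,s_N)$ of swap locations is stationary; that is, $(s_1,\ldots,s_{N-1})$ and $(s_2,\ldots,s_N)$ are equal in law. (ii) The first swap location $s_1=s_1(\omega_n)$ satisfies the convergence in distribution $$\frac{2 s_1(\omega_n)}{n}-1 \Longrightarrow Z\qquad\text{as } n\to\infty,$$ where $Z$ is a random variable with semicircle law, that is, with probability density function $\frac{2}{\pi}\sqrt{1-y^2}$ for $y\in(-1,1)$.
   Context: Let $\mathcal S_n$ be the symmetric group of all permutations of $\{1,\ldots,n\}$, with composition $(\sigma\tau)(i)=\sigma(\tau(i))$. For $1\le s\le n-1$ let $\tau_s=(s\ \ s+1)\in\mathcal S_n$ be the adjacent transposition at location $s$, and let $\rho=(n,n-1,\ldots,1)$ be the reverse permutation. Put $N=\binom n2$. An $n$-element sorting network is a sequence $\omega=(s_1,\ldots,s_N)$ of elements of $\{1,\dots,n-1\}$ such that $\tau_{s_1}\tau_{s_2}\cdots\tau_{s_N}=\rho$. The number $s_k=s_k(\omega)$ is called the $k$th swap location. A uniform $n$-element sorting network is a random element of the (finite) set of all $n$-element sorting networks with uniform distribution. *)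

(* Defs.v *)
From HB Require Import structures.
From mathcomp Require Import all_boot all_order all_algebra all_fingroup.
From mathcomp Require Import all_classical all_reals all_analysis.

Set Implicit Arguments.
Unset Strict Implicit.
Unset Printing Implicit Defensive.

Import Order.TTheory GRing.Theory Num.Theory.
Import numFieldNormedType.Exports.

Local Open Scope classical_set_scope.
Local Open Scope ring_scope.

(* The element i : 'I_n stands for i + 1 in {1, ..., n}, whereas swap locations
   are natural numbers with their usual values 1, ..., n - 1.  Outside this
   range [adjacent_transposition n s] is a junk value (the identity). *)
Definition adjacent_transposition (n s : nat) : 'S_n :=
  match insub s.-1, insub s with
  | Some i, Some j => tperm i j
  | _, _ => 1%g
  end.

Definition reverse_permutation (n : nat) : 'S_n := perm (@rev_ord_inj n).

(* The product of 'S_n is (s * t) i = t (s i); composition in the convention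
   (s t)(i) = s (t i) is therefore the product taken in the opposite order. *)
Definition compose_transpositions (n : nat) (w : seq nat) : 'S_n :=
  foldr (fun s p => (p * adjacent_transposition n s)%g) 1%g w.

Definition is_sorting_network (n : nat) (w : 'C(n, 2).-tuple nat) : bool :=
  all (fun s => (0 < s < n)%N) w
  && (compose_transpositions n w == reverse_permutation n).

Definition sorting_networks (n : nat) : set ('C(n, 2).-tuple nat) :=
  [set w | is_sorting_network w].
Arguments sorting_networks : clear implicits.

(* Meant for a finite nonempty S. *)
Definition uniformly_distributed (R : realType) d (T : measurableType d)
    (P : probability T R) d' (T' : measurableType d') (X : {RV P >-> T'})
    (S : set T') : Prop :=
  forall A : set T', measurable A ->
    distribution P X A = (counting (A `&` S) / counting S)%E.

Definition equal_in_law (R : realType) d (T : measurableType d)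
    (P : probability T R) d' (T' : measurableType d') (X Y : {RV P >-> T'}) :
  Prop :=
  forall A : set T', measurable A -> distribution P X A = distribution P Y A.

Lemma measurable_nth_tuple m k :
  measurable_fun [set: m.-tuple nat] (fun w : m.-tuple nat => nth 0%N w k).
Proof.
have [km|mk] := ltnP k m; last first.
  rewrite (_ : (fun _ => _) = cst 0%N) //.
  by apply/funext => w; rewrite nth_default // size_tuple.
rewrite (_ : (fun _ => _) = @tnth _ nat ^~ (Ordinal km)).
  exact: measurable_tnth.
by apply/funext => w; rewrite (tnth_nth 0%N).
Qed.

(* k is counted from 1; the value is 0 when k > m (for k = 1, when n < 2). *)
Definition swap_location (m k : nat) (w : m.-tuple nat) : nat :=
  nth 0%N w k.-1.

HB.instance Definition _ m k := isMeasurableFun.Build _ _ _ _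
  (@swap_location m k) (@measurable_nth_tuple m k.-1).

Definition omit_last (m : nat) (w : m.-tuple nat) : m.-1.-tuple nat :=
  [tuple swap_location i.+1 w | i < m.-1].

Definition omit_first (m : nat) (w : m.-tuple nat) : m.-1.-tuple nat :=
  [tuple swap_location i.+2 w | i < m.-1].

Lemma measurable_omit_last m : measurable_fun [set: m.-tuple nat] (@omit_last m).
Proof.
apply/measurable_fun_tnthP => i.
rewrite (_ : _ \o _ = @swap_location m i.+1); first exact: measurable_nth_tuple.
by apply/funext => w /=; rewrite tnth_mktuple.
Qed.

Lemma measurable_omit_first m :
  measurable_fun [set: m.-tuple nat] (@omit_first m).
Proof.
apply/measurable_fun_tnthP => i.
rewrite (_ : _ \o _ = @swap_location m i.+2); first exact: measurable_nth_tuple.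
by apply/funext => w /=; rewrite tnth_mktuple.
Qed.

HB.instance Definition _ m := isMeasurableFun.Build _ _ _ _
  (@omit_last m) (@measurable_omit_last m).
HB.instance Definition _ m := isMeasurableFun.Build _ _ _ _
  (@omit_first m) (@measurable_omit_first m).

Definition rescale (R : realType) (n s : nat) : R := 2 * s%:R / n%:R - 1.

Lemma measurable_rescale (R : realType) n :
  measurable_fun [set: nat] (@rescale R n).
Proof. by []. Qed.

HB.instance Definition _ (R : realType) n := isMeasurableFun.Build _ _ _ _
  (@rescale R n) (@measurable_rescale R n).

Definition semicircle_pdf (R : realType) (y : R) : R :=
  if -1 < y < 1 then 2 / pi * Num.sqrt (1 - y ^+ 2) else 0.

Definition has_density (R : realType) d (T : measurableType d)
    (P : probability T R) (X : {RV P >-> R}) (f : R -> R) : Prop :=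
  forall A : set R, measurable A ->
    distribution P X A = (\int[lebesgue_measure]_(x in A) (f x)%:E)%E.

(* The X n may live on different probability spaces. *)
Definition converges_in_distribution (R : realType)
    (d : nat -> measure_display) (T : forall n, measurableType (d n))
    (P : forall n, probability (T n) R) (X : forall n, {RV (P n) >-> R})
    d' (T' : measurableType d') (Q : probability T' R) (Z : {RV Q >-> R}) :
  Prop :=
  forall x : R, {for x, continuous (cdf Z)} ->
    cdf (X n) x @[n --> \oo] --> cdf Z x.

(* Main.v *)
(** Stationarity: if (s_1, ..., s_N) is a sorting network, then so is
    (n - s_N, s_1, ..., s_{N-1}), because conjugation by the reverse permutation
    exchanges the adjacent transpositions at locations s and n - s.

    Law of s_1: let d_s be the s-th divided difference on functions of
    x_1, ..., x_n, let D be the sum of the d_s, and let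
    x^delta = x_1^{n-1} x_2^{n-2} ... x_{n-1}.  A composite of N divided differences
    maps x^delta to 1 if the word of its indices is a sorting network, and to 0
    otherwise; hence D^N x^delta is the number of networks, and d_s D^{N-1} x^delta
    the number of those with s_1 = s.  The series e^{tD} x^delta is the determinant G
    of the coefficients of e^{tz} / ((1 - x_1 z) ... (1 - x_i z)): it satisfies
    dG/dt = D G, since d_i differentiates exactly one row, up to a multiple of the
    neighbouring row.  The leading coefficients in t of G and of d_s G are
    Vandermonde determinants, which gives P(s_1 = s) = e_s e_{n-s} / N with
    e_m = (3/2) (5/4) ... ((2m-1) / (2m-2)).

    Limit: e_m^2 / m increases and e_m^2 / (m - 1/2) decreases, so that e_m^2 is K m
    up to a bounded error, and P(s_1 = s) is a constant times the semicircle
    mass of the s-th cell up to O(n^{-3/2}).  Both laws have total mass 1, so this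
    constant tends to 1 and the value of K is irrelevant. *)

Require Import Defs.
From HB Require Import structures.
From mathcomp Require Import all_boot all_order all_algebra all_fingroup.
From mathcomp Require Import all_classical all_reals all_analysis.
From mathcomp Require Import measurable_realfun finmap ring lra zify.

Set Implicit Arguments.
Unset Strict Implicit.
Unset Printing Implicit Defensive.

Import Order.TTheory GRing.Theory Num.Theory.
Import numFieldNormedType.Exports.

Local Open Scope classical_set_scope.
Local Open Scope ring_scope.

(** * The determinant solving dG/dt = D G *)

Section StaircaseDeterminant.
Variable F : numFieldType.
Implicit Types (x : nat -> F) (r k p q n : nat).

Definition swap_coords r x : nat -> F :=
  fun i => if i == r then x r.+1 else if i == r.+1 then x r else x i.

Lemma swap_coords_inj r x : injective x -> injective (swap_coords r x).
Proof.
move=> xI i j; rewrite /swap_coords.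
case: (i =P r) => ?; case: (i =P r.+1) => ?; case: (j =P r) => ?;
  case: (j =P r.+1) => ? => /xI; lia.
Qed.

Lemma swap_coords_out r x j : j != r -> j != r.+1 -> swap_coords r x j = x j.
Proof. by rewrite /swap_coords => /negbTE-> /negbTE->. Qed.

(** The coefficients of B(z) / (1 - y z), where B(z) is the series with coefficients [B]. *)
Fixpoint geom_step (y : F) (B : nat -> {poly F}) k : {poly F} :=
  if k is k'.+1 then B k + y%:P * geom_step y B k' else B 0%N.

(* The coefficient of z^k in e^{tz} / ((1 - x_0 z) ... (1 - x_{i-1} z)), as a
   polynomial in t. *)
Fixpoint exp_complete i x : nat -> {poly F} :=
  if i is i'.+1 then geom_step (x i') (exp_complete i' x)
  else fun k => (k`!%:R^-1) *: 'X^k.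

Local Notation H := exp_complete.

Lemma eq_geom_step y B C : B =1 C -> geom_step y B =1 geom_step y C.
Proof. by move=> BC; elim=> [|k IH] /=; rewrite ?IH BC. Qed.

(** Partial fractions: (a - b) z / ((1 - a z) (1 - b z)) = 1 / (1 - a z) - 1 / (1 - b z). *)
Lemma geom_step2 a b B k :
  (a - b)%:P * geom_step b (geom_step a B) k
  = geom_step a B k.+1 - geom_step b B k.+1.
Proof.
elim: k => [|k IH]; first by rewrite /= polyCB; ring.
have -> : geom_step b (geom_step a B) k.+1
        = geom_step a B k.+1 + b%:P * geom_step b (geom_step a B) k by [].
rewrite mulrDr mulrCA IH.
have S c : geom_step c B k.+2 = B k.+2 + c%:P * geom_step c B k.+1 by [].
by rewrite !S polyCB; ring.
Qed.

(** In [geom_step2] both the factor a - b and the right-hand side are antisymmetric in a and b. *)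
Lemma geom_stepC a b B k : a != b ->
  geom_step b (geom_step a B) k = geom_step a (geom_step b B) k.
Proof.
move=> ab; have ab0 : (a - b)%:P != 0 by rewrite polyC_eq0 subr_eq0.
apply: (mulfI ab0); rewrite geom_step2; apply: oppr_inj.
by rewrite opprB -mulNr -polyCN opprB geom_step2.
Qed.

Lemma exp_complete0 i x : H i x 0 = 1.
Proof. by elim: i => [|i IH] //=; rewrite fact0 invr1 scale1r expr0. Qed.

Lemma exp_completeS i x k : H i.+1 x k.+1 = H i x k.+1 + (x i)%:P * H i.+1 x k.
Proof. by []. Qed.

(** Differentiating e^{tz} in t multiplies the series by z. *)
Lemma deriv_exp_complete i x k : (H i x k.+1)^`() = H i x k.
Proof.
elim: i k => [|i IH] k.
  rewrite /= derivZ derivXn factS natrM invfM -['X^_ *+ _]scaler_nat scalerA.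
  by rewrite mulrAC mulVf ?mul1r// pnatr_eq0.
elim: k => [|k IHk]; rewrite exp_completeS derivD IH derivM derivC mul0r add0r.
  by rewrite !exp_complete0 derivC mulr0 addr0.
by rewrite IHk.
Qed.

Lemma eq_exp_complete i x y k :
  (forall j, (j < i)%N -> x j = y j) -> H i x k = H i y k.
Proof.
elim: i k => [|i IH] //= k xy; rewrite xy//.
by apply: eq_geom_step => l; apply: IH => j ji; apply: xy; lia.
Qed.

Lemma exp_complete_swap_lt r x i k : (i <= r)%N ->
  H i (swap_coords r x) k = H i x k.
Proof.
by move=> ir; apply: eq_exp_complete => j ji; apply: swap_coords_out; lia.
Qed.

(** Of the factors 1 / (1 - x_j z) with j <= r, the swap changes only the last one, so [geom_step2]
    applies. *)
Lemma exp_complete_divdiff r x k :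
  H r.+1 x k.+1 - H r.+1 (swap_coords r x) k.+1
   = (x r - x r.+1)%:P * H r.+2 x k.
Proof.
have Hsw : H r.+1 (swap_coords r x) =1 geom_step (x r.+1) (H r x).
  move=> l; rewrite [LHS]/= [swap_coords r x r]/swap_coords eqxx.
  by apply: eq_geom_step => j; exact: exp_complete_swap_lt.
by rewrite Hsw geom_step2.
Qed.

(** Both swapped coordinates occur, and the product of their factors is symmetric. *)
Lemma exp_complete_swap_ge r x i k : injective x -> (r.+2 <= i)%N ->
  H i (swap_coords r x) k = H i x k.
Proof.
move=> xI; elim: i k => // i IH k; rewrite leq_eqVlt => /orP[/eqP [<-]|ri] /=.
  rewrite [swap_coords r x r]/swap_coords [swap_coords r x r.+1]/swap_coords.
  rewrite !eqxx eqn_leq ltnn/= geom_stepC; last first.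
    by apply/eqP => /xI; lia.
  by do 2 apply: eq_geom_step => ?; exact: exp_complete_swap_lt.
have -> : swap_coords r x i = x i by apply: swap_coords_out; lia.
by apply: eq_geom_step => l; apply: IH.
Qed.

(* The coefficient of index p - q, with the convention that truncated subtraction
   does not give: it vanishes for p < q. *)
Definition exp_complete_sub i x p q : {poly F} :=
  if (q <= p)%N then H i x (p - q) else 0.
Local Notation K := exp_complete_sub.

Lemma deriv_exp_complete_sub i x p q : (K i x p q)^`() = K i x p q.+1.
Proof.
rewrite /K; have [qp|pq|->] := ltngtP q p.
- have -> : (p - q = (p - q.+1).+1)%N by lia.
  exact: deriv_exp_complete.
- by rewrite deriv0.
- by rewrite subnn exp_complete0 derivC.
Qed.

Lemma exp_complete_subS i x p q :
  K i.+1 x p q = K i x p q + (x i)%:P * K i.+1 x p q.+1.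
Proof.
rewrite /K; have [qp|pq|->] := ltngtP q p.
- have -> : (p - q = (p - q.+1).+1)%N by lia.
  exact: exp_completeS.
- by rewrite mulr0 addr0.
- by rewrite subnn !exp_complete0 mulr0 addr0.
Qed.

Lemma exp_complete_sub_divdiff r x p q :
  K r.+1 x p q - K r.+1 (swap_coords r x) p q
   = (x r - x r.+1)%:P * K r.+2 x p q.+1.
Proof.
rewrite /K; have [qp|pq|->] := ltngtP q p.
- have -> : (p - q = (p - q.+1).+1)%N by lia.
  exact: exp_complete_divdiff.
- by rewrite subr0 mulr0.
- by rewrite subnn !exp_complete0 mulr0 subrr.
Qed.

Lemma exp_complete_sub_swap r x i p q : injective x -> i != r.+1 ->
  K i (swap_coords r x) p q = K i x p q.
Proof.
move=> xI ir; rewrite /K; case: ifP => // _.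
have [?|?] := leqP i r; first exact: exp_complete_swap_lt.
apply: exp_complete_swap_ge => //; lia.
Qed.

Lemma exp_complete_subSS i x p q : K i x p.+1 q.+1 = K i x p q.
Proof. by rewrite /K ltnS subSS. Qed.

(** Row i is built from the first n - i coordinates, so that swapping the coordinates s - 1 and s
    affects row n - s only. *)
Definition staircase_mx n x : 'M[{poly F}]_n :=
  \matrix_(i, j) K (n - i) x i.*2 j.

Definition mx_with_row (R : Type) n (A : 'M[R]_n) (i0 : nat) (v : 'I_n -> R) : 'M[R]_n :=
  \matrix_(i, j) if i == i0 :> nat then v j else A i j.

Lemma det_mx_with_row_linear (R : comNzRingType) n (A : 'M[R]_n) (i0 : 'I_n) u v w a b :
  (forall j, u j = a * v j + b * w j) ->
  \det (mx_with_row A i0 u)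
  = a * \det (mx_with_row A i0 v) + b * \det (mx_with_row A i0 w).
Proof.
move=> uvw; apply: (@determinant_multilinear _ _ _ _ _ i0).
- by apply/rowP => j; rewrite !mxE eqxx.
- by apply/matrixP => i j; rewrite !mxE eq_sym val_eqE (negbTE (neq_lift _ _)).
- by apply/matrixP => i j; rewrite !mxE eq_sym val_eqE (negbTE (neq_lift _ _)).
Qed.

Lemma eq_mx_with_row (R : Type) n (A : 'M[R]_n) i0 u v :
  u =1 v -> mx_with_row A i0 u = mx_with_row A i0 v.
Proof. by move=> uv; apply/matrixP => i j; rewrite !mxE uv. Qed.

Lemma mx_with_row_id (R : Type) n (A : 'M[R]_n) (i0 : 'I_n) :
  mx_with_row A i0 (A i0) = A.
Proof. by apply/matrixP => i j; rewrite mxE; case: eqP => [/val_inj->|]. Qed.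

Lemma det_mx_with_row_dup (R : comNzRingType) n (A : 'M[R]_n) (i0 i1 : 'I_n) :
  i0 != i1 -> \det (mx_with_row A i0 (A i1)) = 0.
Proof.
move=> i01; apply: (determinant_alternate i01) => j.
by rewrite !mxE eqxx eq_sym val_eqE (negbTE i01).
Qed.

Lemma det_mx_with_row0 (R : comNzRingType) n (A : 'M[R]_n) (i0 : 'I_n) v :
  (forall j, v j = 0) -> \det (mx_with_row A i0 v) = 0.
Proof.
move=> v0; rewrite (@det_mx_with_row_linear _ _ _ _ v v v 0 0) ?mul0r ?addr0//.
by move=> j; rewrite v0 !mulr0 addr0.
Qed.

Lemma deriv_prod (I : finType) (f : I -> {poly F}) :
  (\prod_i f i)^`() = \sum_k \prod_i (if i == k then (f i)^`() else f i).
Proof.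
suff H (s : seq I) : uniq s ->
    (\prod_(i <- s) f i)^`()
    = \sum_(k <- s) \prod_(i <- s) (if i == k then (f i)^`() else f i).
  exact: H (index_enum_uniq I).
elim: s => [|a s IH] /=; first by rewrite !big_nil derivC.
case/andP=> as_ us; rewrite !big_cons derivM IH// eqxx; congr (_ * _ + _).
  by apply: eq_big_seq => i is_; case: eqP is_ as_ => // -> ->.
rewrite mulr_sumr; apply: eq_big_seq => k ks.
by rewrite big_cons; case: eqP ks as_ => // -> ->.
Qed.

Lemma deriv_det n (A : 'M[{poly F}]_n) :
  (\det A)^`() = \sum_(i < n) \det (mx_with_row A i (fun j => (A i j)^`())).
Proof.
rewrite /determinant raddf_sum exchange_big; apply: eq_bigr => s _ /=.
rewrite -mulr_sumr.
have -> : forall (b : bool) (p : {poly F}),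
    ((-1) ^+ b * p)^`() = (-1) ^+ b * p^`().
  by case=> p; rewrite ?mulN1r ?mul1r ?derivN.
congr (_ * _); rewrite deriv_prod; apply: eq_bigr => k _.
by apply: eq_bigr => i _; rewrite mxE val_eqE; case: eqP => // ->.
Qed.


(* Junk value 0 when x_r = x_{r+1}: all statements below are about injective x. *)
Definition divdiff r (f : (nat -> F) -> F) x : F :=
  (f x - f (swap_coords r x)) / (x r - x r.+1).

(** Locations are counted from 1 and coordinates from 0, hence the shift [s.-1]. *)
Definition divdiff_sum n (f : (nat -> F) -> F) x : F :=
  \sum_(1 <= s < n) divdiff s.-1 f x.

(** The new row is the divided difference of row n - s, as computed in
    [exp_complete_sub_divdiff]. *)
Definition staircase_lowered n s x :=
  mx_with_row (staircase_mx n x) (n - s) (fun j => K s.+1 x (n - s).*2 j.+1).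

(** Linearity of the determinant in the only row that the swap changes. *)
Lemma staircase_divdiff n s x : injective x -> (0 < s < n)%N ->
  \det (staircase_mx n x) - \det (staircase_mx n (swap_coords s.-1 x))
  = (x s.-1 - x s)%:P * \det (staircase_lowered n s x).
Proof.
move=> xI /andP[s0 sn]; have ns : (n - s < n)%N by lia.
pose i0 := Ordinal ns; set M := staircase_mx n x.
have Ms : staircase_mx n (swap_coords s.-1 x)
    = mx_with_row M i0 (fun j => K s (swap_coords s.-1 x) (n - s).*2 j).
  apply/matrixP => i j; rewrite !mxE; case: eqP => /= [->|ne].
    by rewrite subKn// ltnW.
  by rewrite exp_complete_sub_swap//; have := ltn_ord i; lia.
rewrite Ms -(mx_with_row_id M i0) /staircase_lowered.
rewrite (@det_mx_with_row_linear _ _ _ i0 (M i0) (fun j => K s (swap_coords s.-1 x) (n - s).*2 j)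
   (fun j => K s.+1 x (n - s).*2 j.+1) 1 (x s.-1 - x s)%:P) => [|j].
  rewrite mx_with_row_id mul1r addrAC subrr add0r //.
rewrite mul1r mxE subKn ?(ltnW sn)//.
have := exp_complete_sub_divdiff s.-1 x (n - s).*2 j; rewrite prednK// => <-.
by rewrite addrC subrK.
Qed.

(* The derivative in t of row n - s differs from [staircase_lowered] by a multiple of
   row n - s - 1, and row 0 is constant. *)
Lemma deriv_staircase n x :
  (\det (staircase_mx n x))^`() = \sum_(1 <= s < n) \det (staircase_lowered n s x).
Proof.
rewrite deriv_det big_nat_rev/=.
set M := staircase_mx n x.
pose row i j := K (n - i) x i.*2 j.+1.
transitivity (\sum_(0 <= i < n) \det (mx_with_row M i (row i))).
  rewrite big_mkord; apply: eq_bigr => i _; congr (\det _).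
  by apply: eq_mx_with_row => j; rewrite mxE deriv_exp_complete_sub.
case: n @M @row => [|n] M row; first by rewrite !big_nil.
have row0 : \det (mx_with_row M 0 (row 0%N)) = 0.
  exact: (@det_mx_with_row0 _ _ M ord0).
rewrite [LHS]big_ltn// row0 add0r.
apply: eq_big_nat => i /andP[i0 ltin]; rewrite add1n subSS.
have ni : (n.+1 - i < n.+1)%N by lia.
rewrite /staircase_lowered -/M subKn ?(ltnW ltin)//.
pose io := Ordinal ltin; have ltip : (i.-1 < n.+1)%N by lia.
rewrite [RHS](@det_mx_with_row_linear _ _ _ io _ (row i) (M (Ordinal ltip)) 1
  (x (n.+1 - i)%N)%:P) => [|j].
  rewrite det_mx_with_row_dup ?mulr0 ?addr0 ?mul1r//.
  by apply/eqP => /(congr1 val)/=; lia.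
rewrite mul1r mxE /row/= exp_complete_subS; congr (_ + _ * _).
(* The exponents 2 i grow by two per row precisely so that this remainder is a multiple of row i -
   1. *)
have -> : (i.*2 = i.-1.*2.+2)%N by lia.
by rewrite !exp_complete_subSS; congr K; lia.
Qed.

(** Compares the coefficients of t^k in dG/dt = D G. *)
Lemma divdiff_sum_staircase n k x : injective x ->
  divdiff_sum n (fun y => (\det (staircase_mx n y))`_k) x
  = (\det (staircase_mx n x))`_k.+1 *+ k.+1.
Proof.
move=> xI; rewrite -coef_deriv deriv_staircase coef_sum.
apply: eq_big_nat => s sn; rewrite /divdiff prednK; last by case/andP: sn.
rewrite -coefB staircase_divdiff// coefCM mulrAC mulfV ?mul1r//.
rewrite subr_eq0; apply/eqP => /xI; lia.
Qed.

Lemma divdiff_staircase n s k x : injective x -> (0 < s < n)%N ->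
  divdiff s.-1 (fun y => (\det (staircase_mx n y))`_k) x
  = (\det (staircase_lowered n s x))`_k.
Proof.
move=> xI sn; rewrite /divdiff prednK; last by case/andP: sn.
rewrite -coefB staircase_divdiff// coefCM mulrAC mulfV ?mul1r//.
rewrite subr_eq0; apply/eqP => /xI; lia.
Qed.

Lemma eq_divdiff_sum n f g x : injective x ->
  (forall y, injective y -> f y = g y) -> divdiff_sum n f x = divdiff_sum n g x.
Proof.
move=> xI fg; apply: eq_bigr => s _.
by rewrite /divdiff !fg//; apply: swap_coords_inj.
Qed.

Lemma divdiff_sumMn n f m x :
  divdiff_sum n (fun y => f y *+ m) x = divdiff_sum n f x *+ m.
Proof. by rewrite -sumrMnl; apply: eq_bigr => s _; rewrite /divdiff -mulrnBl mulrnAl. Qed.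

Lemma iter_divdiff_sum_staircase n k x : injective x ->
  iter k (divdiff_sum n) (fun y => (\det (staircase_mx n y))`_0) x
  = (\det (staircase_mx n x))`_k *+ k`!.
Proof.
elim: k x => [|k IH] x xI //; rewrite iterS.
rewrite (eq_divdiff_sum n xI IH) divdiff_sumMn divdiff_sum_staircase//.
by rewrite factS -mulrnA.
Qed.

End StaircaseDeterminant.

(** * The determinant at t = 0 *)

Section InitialValue.
Variable F : numFieldType.
Implicit Types (x : nat -> F) (r k p q n : nat).
Local Notation H := exp_complete.
Local Notation K := exp_complete_sub.

(** By symmetry, the factor adjoined last may be that of x_0 instead of x_i. *)
Lemma exp_complete_recl i x : injective x ->
  H i.+1 x =1 geom_step (x 0) (H i (x \o succn)).
Proof.
move=> xI; elim: i => [|i IH] k; first by apply: eq_geom_step.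
rewrite [LHS]/= (eq_geom_step _ IH) geom_stepC//.
by apply/eqP => /xI.
Qed.

Lemma exp_complete_sub_recl i x p q : injective x ->
  K i.+1 x p q = K i (x \o succn) p q + (x 0)%:P * K i.+1 x p q.+1.
Proof.
move=> xI; rewrite /K; have [qp|pq|->] := ltngtP q p.
- have -> : (p - q = (p - q.+1).+1)%N by lia.
  by rewrite !(exp_complete_recl _ xI).
- by rewrite mulr0 addr0.
- by rewrite subnn !exp_complete0 mulr0 addr0.
Qed.

Lemma exp_complete1_coef0 x k : (H 1 x k)`_0 = x 0 ^+ k.
Proof.
elim: k => [|k IH]; first by rewrite exp_complete0 coef1 expr0.
by rewrite exp_completeS coefD coefCM IH /= coefZ coefXn mulr0 add0r exprS.
Qed.

(* Subtracting x_0 times the next column from every column eliminates x_0, except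
   from the last column. *)
Lemma staircase_coef0 n x : injective x ->
  (\det (staircase_mx n x))`_0 = \prod_(i < n) x i ^+ (n - i.+1).
Proof.
have c0 (p : {poly F}) : p`_0 = horner_eval 0 p by rewrite /horner_eval horner_coef0.
have cdet m (y : nat -> F) : (\det (staircase_mx m y))`_0
    = \det (\matrix_(i < m, j < m) (K (m - i) y i.*2 j)`_0).
  rewrite c0 -det_map_mx; congr (\det _).
  by apply/matrixP => i j; rewrite !mxE c0.
elim: n x => [|n IH] x xI; first by rewrite big_ord0 det_mx00 coef1.
rewrite cdet; set A := \matrix_(_, _) _.
pose U : 'M[F]_n.+1 := \matrix_(i, j) ((i == j)%:R - x 0%N * (i == j.+1 :> nat)%:R).
have dU : \det U = 1.
  rewrite det_trig; last first.
    apply/is_trig_mxP => i j ij; rewrite mxE.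
    by rewrite -val_eqE !ltn_eqF//= ?mulr0 ?subrr// ltnW.
  rewrite big1// => i _; rewrite mxE eqxx ltn_eqF// mulr0 subr0 //.
have AU (i j : 'I_n.+1) : (j < n)%N ->
    (A *m U) i j = (K (n - i) (x \o succn) i.*2 j)`_0.
  move=> jn; have jn1 : (j.+1 < n.+1)%N by [].
  rewrite mxE (bigD1 j)//= (bigD1 (Ordinal jn1))/=; last by rewrite -val_eqE/=; lia.
  rewrite big1 => [|k /andP[kj kj1]]; last first.
    rewrite !mxE (negbTE kj) -[_ == j.+1]/(k == Ordinal jn1 :> nat) val_eqE (negbTE kj1).
    by rewrite mulr0 subr0 mulr0.
  rewrite !mxE eqxx /= eqxx -!val_eqE/= (ltn_eqF (ltnSn _)) (gtn_eqF (ltnSn _)).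
  rewrite mulr0 mulr1 subr0 mulr1 addr0 sub0r.
  by rewrite subSn ?leq_ord// (exp_complete_sub_recl _ _ _ xI) coefD coefCM mulrN mulrC addrK.
have -> : \det A = \det (A *m U) by rewrite det_mulmx dU mulr1.
(* Before its last entry, the last row now consists of the coefficients t^k / k! of e^{tz} with k >
   0, which vanish at t = 0; the last entry is x_0^n. *)
rewrite (expand_det_row _ ord_max) big_ord_recr/= big1 => [|j _]; last first.
  rewrite AU ?subnn /=; last by [].
  rewrite /K; case: ifP => _; rewrite ?coef0 ?mul0r//=.
  rewrite coefZ coefXn; case: eqP; rewrite ?mulr0 ?mul0r// => E; have := ltn_ord j.
  lia.
rewrite add0r mxE (bigD1 ord_max)//= big1 => [|j jm]; last first.
  by rewrite !mxE (negbTE jm) ltn_eqF ?mulr0 ?subrr ?mulr0.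
rewrite !mxE eqxx /= ltn_eqF// mulr0 subr0 mulr1 addr0 subSnn.
rewrite /K -addnn leq_addr addnK exp_complete1_coef0.
rewrite big_ord_recl/= subSS subn0; congr (_ * _).
rewrite /cofactor -signr_odd addnn odd_double expr0 mul1r.
rewrite -(IH (x \o succn)) ?cdet; last by move=> a b /xI [].
congr (\det _); apply/matrixP => i j; rewrite mxE mxE AU lift_max ?lift_max//.
by rewrite mxE.
Qed.
End InitialValue.

(** * Leading coefficients in t as Vandermonde determinants *)

Section LeadingCoefficients.
Variable F : numFieldType.
Implicit Types (x : nat -> F) (r k p q n : nat).
Local Notation H := exp_complete.
Local Notation K := exp_complete_sub.

Lemma size_coef_prod (I : finType) (f : I -> {poly F}) (l : I -> nat) :
  (forall i, size (f i) <= (l i).+1)%N ->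
  (size (\prod_i f i)%R <= (\sum_i l i).+1)%N
  /\ (\prod_i f i)`_(\sum_i l i) = \prod_i (f i)`_(l i).
Proof.
move=> fl; elim/big_ind3 : _ => //.
- by rewrite size_poly1 coef1.
- move=> c m p c' k q [pm <-] [qk <-]; split.
    by apply: leq_trans (size_polyMleq _ _) _; rewrite -subn1 leq_subLR;
    apply: leq_trans (leq_add pm qk) _; lia.
  rewrite coefM (bigD1 (Ordinal (leq_addr k m : m < (m + k).+1)%N))//= addKn.
  rewrite big1 ?addr0// => -[i im] /eqP /= ne.
  have {}ne : i != m by apply/eqP => E; apply: ne; apply: val_inj.
  have [?|?] := ltnP i m; last by rewrite [p`_i]nth_default ?mul0r//; apply: leq_trans pm _; lia.
  by rewrite [q`_ _]nth_default ?mulr0//=; apply: leq_trans qk _; lia.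
Qed.

(* The leading coefficient in each row is enough, because the degree bounds of the
   entries depend only on the row. *)
Lemma coef_det_homog n (A : 'M[{poly F}]_n) (l : 'I_n -> nat) :
  (forall i j, size (A i j) <= (l i).+1)%N ->
  (\det A)`_(\sum_i l i) = \det (\matrix_(i, j) (A i j)`_(l i)).
Proof.
move=> Al; rewrite /determinant coef_sum; apply: eq_bigr => s _.
have -> : forall (b : bool) (p : {poly F}) k, ((-1) ^+ b * p)`_k = (-1) ^+ b * p`_k.
  by case=> p k; rewrite ?mulN1r ?mul1r ?coefN.
have [_ ->] := size_coef_prod (fun i => Al i (s i)).
by congr (_ * _); apply: eq_bigr => i _; rewrite mxE.
Qed.

(** The coefficient of t^{p - q} in [exp_complete_sub i x p q], the same for all i and x. *)
Definition inv_fact_sub p q : F := if (q <= p)%N then (p - q)`!%:R^-1 else 0.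

(** The top power of t comes from e^{tz} alone: every z taken from a factor 1 / (1 - x_j z) costs
    one power of t. *)
Lemma exp_complete_top i x k : (size (H i x k) <= k.+1)%N /\ (H i x k)`_k = k`!%:R^-1.
Proof.
elim: i k => [|i IH] k.
  rewrite /= coefZ coefXn eqxx mulr1; split=> //.
  by apply: leq_trans (size_scale_leq _ _) _; rewrite size_polyXn.
elim: k => [|k [IH1 IH2]]; first by rewrite exp_complete0 coef1 size_poly1 fact0 invr1.
have [? E] := IH k.+1.
rewrite exp_completeS coefD coefCM E [(H i.+1 x k)`_k.+1]nth_default// mulr0 addr0.
split=> //; apply: leq_trans (size_polyD _ _) _; rewrite geq_max; apply/andP; split=> //.
rewrite mul_polyC; apply: leq_trans (size_scale_leq _ _) _; lia.
Qed.

Lemma coef_det_exp_complete n x (h l : 'I_n -> nat) d :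
  (d + \sum_(j < n) j = \sum_i l i)%N ->
  (\det (\matrix_(i < n, j < n) K (h i) x (l i) j))`_d
  = \det (\matrix_(i < n, j < n) inv_fact_sub (l i) j).
Proof.
move=> dl; set A := \matrix_(_, _) _.
(* Multiplying column j by t^j makes the degree bound of row i equal to [l i] in every column. *)
pose D : 'M[{poly F}]_n := diag_mx (\row_j 'X^(j : nat)).
have -> : (\det A)`_d = (\det (A *m D))`_(\sum_i l i).
  rewrite det_mulmx det_diag -dl.
  rewrite (_ : \prod_i _ = 'X^(\sum_(j < n) j)).
    by rewrite coefMXn ltnNge leq_addl addnK.
  by rewrite -prodrXr; apply: eq_bigr => i _; rewrite mxE.
have E i j : (size ((A *m D) i j) <= (l i).+1)%N /\
    ((A *m D) i j)`_(l i) = inv_fact_sub (l i) j.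
  rewrite mul_mx_diag !mxE /K /inv_fact_sub.
  case: (leqP j (l i)) => jl; last by rewrite mul0r size_poly0 coef0.
  have [s c] := exp_complete_top (h i) x (l i - j).
  rewrite coefMXn ltnNge jl /= c; split=> //.
  by apply: leq_trans (size_polyMleq _ _) _; rewrite size_polyXn; lia.
rewrite coef_det_homog => [|i j]; last by have [] := E i j.
by congr (\det _); apply/matrixP => i j; rewrite mxE (proj2 (E i j)) mxE.
Qed.

Definition ffact_poly k : {poly F} := \prod_(i < k) ('X - (i%:R)%:P).

Lemma horner_ffact_poly k m : (ffact_poly k).[m%:R] = (m ^_ k)%:R.
Proof.
rewrite /ffact_poly horner_prod; elim: k => [|k IH]; first by rewrite big_ord0 ffactn0.
rewrite big_ord_recr/= IH hornerXsubC ffactnSr natrM.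
have [km|mk] := leqP k m; first by rewrite natrB.
by rewrite ffact_small// !mul0r.
Qed.

(** 1 / (l - j)! is the falling factorial of l of length j, divided by l!. As polynomials in l, the
    falling factorials are monic of degree j, so a unitriangular matrix turns the powers into
    them. *)
Lemma det_inv_fact_sub n (l : 'I_n -> nat) :
  \det (\matrix_(i < n, j < n) inv_fact_sub (l i) j)
  = (\prod_i ((l i)`!%:R^-1)) * \prod_(i < n) \prod_(j < n | (i < j)%N) ((l j)%:R - (l i)%:R).
Proof.
pose v : 'rV[F]_n := \row_i (l i)%:R.
pose C : 'M[F]_n := \matrix_(k, j) (ffact_poly j)`_k.
have sz k : size (ffact_poly k) = k.+1 by rewrite size_prod_XsubC /index_enum -enumT size_enum_ord.
have dC : \det C = 1.
  rewrite -det_tr det_trig; last first.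
    apply/is_trig_mxP => i j ij; rewrite !mxE nth_default//.
    by rewrite sz.
  rewrite big1// => i _; rewrite !mxE.
  by have /monicP := monic_prod_XsubC (index_enum 'I_i) predT (fun j => (j : nat)%:R : F);
    rewrite /lead_coef -/(ffact_poly i) sz.
transitivity (\det (diag_mx (\row_i ((l i)`!%:R^-1)) *m ((Vandermonde n v)^T *m C))); last first.
  rewrite !det_mulmx dC mulr1 det_tr det_Vandermonde det_diag; congr (_ * _).
    by apply: eq_bigr => i _; rewrite mxE.
  by apply: eq_bigr => i _; apply: eq_bigr => j _; rewrite !mxE.
congr (\det _); apply/matrixP => i j; rewrite mul_diag_mx !mxE.
have -> : \sum_k (Vandermonde n v)^T i k * C k j = (l i ^_ j)%:R.
  rewrite -horner_ffact_poly (@horner_coef_wide _ n) ?sz//.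
  by apply: eq_bigr => k _; rewrite !mxE mulrC.
rewrite /inv_fact_sub; case: leqP => [jl|lj]; last by rewrite ffact_small ?mulr0.
rewrite -(ffact_fact jl) natrM invfM -mulrA mulrC -mulrA mulfV ?mulr1//.
by rewrite pnatr_eq0 -lt0n ffact_gt0.
Qed.

Lemma sum_ord_bin2 n : (\sum_(j < n) j)%N = 'C(n, 2).
Proof. by rewrite -bin2_sum big_mkord. Qed.

Lemma coef_staircase n x :
  (\det (staircase_mx n x))`_('C(n, 2)) = \det (\matrix_(i < n, j < n) inv_fact_sub i.*2 j).
Proof.
apply: coef_det_exp_complete; rewrite sum_ord_bin2 -sum_ord_bin2 -big_split/=.
by apply: eq_bigr => i _; rewrite addnn.
Qed.

Definition lowered_exponent (i0 i : nat) : nat := if i == i0 then i.*2.-1 else i.*2.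

(** In the lowered row, the shift from j to j + 1 is absorbed by passing from the exponent 2 i to 2
    i - 1. *)
Lemma coef_staircase_lowered n s x : (0 < s < n)%N ->
  (\det (staircase_lowered n s x))`_('C(n, 2).-1)
  = \det (\matrix_(i < n, j < n) inv_fact_sub (lowered_exponent (n - s) i) j).
Proof.
move=> /andP[s0 sn]; pose h (i : 'I_n) := if i == (n - s)%N :> nat then s.+1 else (n - i)%N.
rewrite -(@coef_det_exp_complete _ x h _ 'C(n, 2).-1).
  congr ((polyseq (\det _))`__); apply/matrixP => i j; rewrite !mxE /lowered_exponent /h.
  case: eqP => // ->; rewrite -(exp_complete_subSS _ _ _ j) prednK//; lia.
have ns : (n - s < n)%N by lia.
rewrite sum_ord_bin2; have : (\sum_(i < n) i.*2 = 'C(n, 2).*2)%N.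
  by rewrite -sum_ord_bin2 -addnn -big_split/=; apply: eq_bigr => i _; rewrite addnn.
rewrite (bigD1 (Ordinal ns))//= => E.
rewrite [RHS](bigD1 (Ordinal ns))//= {1}/lowered_exponent eqxx.
rewrite [X in (_ = _ + X)%N](_ : _ = \sum_(i < n | i != Ordinal ns) i.*2)%N.
  move: E; move: (bigop _ _ _) 'C(n, 2) => S C; lia.
apply: eq_bigr => i ine; rewrite /lowered_exponent -val_eqE /= in ine *.
by rewrite (negbTE ine).
Qed.

(** The number e_m. The convention e_0 = 0 allows sums over locations to include s = n. *)
Definition hook_weight m : F :=
  if m is 0 then 0 else \prod_(1 <= k < m) ((k.*2.+1)%:R / (k.*2)%:R).

Lemma hook_weight1 : hook_weight 1 = 1.
Proof. by rewrite /hook_weight big_geq. Qed.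

Lemma hook_weightS m : (0 < m)%N ->
  hook_weight m.+1 = hook_weight m * ((m.*2.+1)%:R / (m.*2)%:R).
Proof. by case: m => // m _; rewrite /hook_weight big_nat_recr. Qed.

(** The product (1/2) (3/4) ... ((2m-1) / (2m)) is what the rows above the lowered one contribute to
    the Vandermonde ratio. *)
Lemma hook_weight_odd m :
  hook_weight m = m.*2%:R * \prod_(1 <= k < m.+1) ((k.*2.-1)%:R / (k.*2)%:R).
Proof.
case: m => [|m]; first by rewrite mul0r.
elim: m => [|m IH].
  by rewrite hook_weight1 big_nat1 mulrCA mulfV ?mulr1// pnatr_eq0.
set P := \prod_(1 <= k < m.+2) _ in IH.
have -> : \prod_(1 <= k < m.+3) ((k.*2.-1)%:R / k.*2%:R)
    = P * ((m.+1.*2.+1)%:R / m.+2.*2%:R) :> F by rewrite big_nat_recr.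
rewrite hook_weightS// IH.
have ? : m.+1.*2%:R != 0 :> F by rewrite pnatr_eq0.
have ? : m.+2.*2%:R != 0 :> F by rewrite pnatr_eq0.
by field; apply/andP; split.
Qed.

(** Only pairs containing i0 change. At distance k, the difference 2 k is multiplied by (2k-1) /
    (2k) if i0 is the larger index and by (2k+1) / (2k) if it is the smaller one. *)
Lemma prod_lowered_differences n i0 : (0 < i0 < n)%N ->
  \prod_(i < n) \prod_(j < n | (i < j)%N)
     ((lowered_exponent i0 j)%:R - (lowered_exponent i0 i)%:R : F)
  = (\prod_(i < n) \prod_(j < n | (i < j)%N) (j.*2%:R - i.*2%:R)) *
    ((\prod_(1 <= k < i0.+1) ((k.*2.-1)%:R / (k.*2)%:R)) * hook_weight (n - i0)).
Proof.
move=> /andP[i00 i0n].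
pose a k : F := (k.*2.-1)%:R / (k.*2)%:R; pose b k : F := (k.*2.+1)%:R / (k.*2)%:R.
pose rho i j := if i == i0 then b (j - i0)%N else if j == i0 then a (i0 - i)%N else 1.
have step (i j : 'I_n) : (i < j)%N ->
    ((lowered_exponent i0 j)%:R - (lowered_exponent i0 i)%:R : F)
    = (j.*2%:R - i.*2%:R) * rho i j.
  move=> ij; rewrite /rho /lowered_exponent.
  have d0 p q : (p < q)%N -> (q - p).*2%:R != 0 :> F by rewrite pnatr_eq0; lia.
  have dd p q : (p <= q)%N -> (q.*2%:R - p.*2%:R = (q - p).*2%:R :> F).
    by move=> pq; rewrite -natrB ?leq_double// doubleB.
  case: eqP => [E|_]; case: eqP => [E'|_]; first by lia.
  - rewrite E /a dd; last by rewrite -E ltnW.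
    rewrite mulrC divfK; last by apply: d0; rewrite -E.
    rewrite -natrB; [congr _%:R|]; lia.
  - rewrite E' /b dd; last by rewrite -E' ltnW.
    rewrite mulrC divfK; last by apply: d0; rewrite -E'.
    rewrite -natrB; [congr _%:R|]; lia.
  - by rewrite mulr1.
transitivity (\prod_(i < n) ((\prod_(j < n | (i < j)%N) (j.*2%:R - i.*2%:R)) *
   \prod_(j < n | (i < j)%N) rho i j)).
  apply: eq_bigr => i _; rewrite -big_split/=; apply: eq_bigr => j ij; exact: step.
rewrite big_split /=; congr (_ * _).
have ri (i : 'I_n) : i != i0 :> nat ->
    \prod_(j < n | (i < j)%N) rho i j = if (i < i0)%N then a (i0 - i)%N else 1.
  move=> ine; case: ltnP => ii.
    rewrite (bigD1 (Ordinal i0n))//= {1}/rho (negbTE ine) eqxx big1 ?mulr1// => j.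
    by move=> /andP[_]; rewrite /rho -val_eqE/= => /negbTE ->; rewrite (negbTE ine).
  rewrite big1// => j ij; rewrite /rho (negbTE ine).
  by case: eqP => // E; move: ij; lia.
rewrite (bigD1 (Ordinal i0n))//= mulrC; congr (_ * _).
  transitivity (\prod_(i < n | (i < i0)%N) a (i0 - i)%N).
    rewrite (eq_bigr (fun i : 'I_n => if (i < i0)%N then a (i0 - i)%N else 1)) => [|i ine];
      last by apply: ri.
    rewrite -big_mkcondr; apply: eq_bigl => i; rewrite -val_eqE/=.
    by case: ltngtP.
  rewrite -(big_mkord (fun i => i < i0)%N (fun i => a (i0 - i)%N)).
  have -> : \prod_(0 <= i < n | (i < i0)%N) a (i0 - i)%N = \prod_(0 <= i < i0) a (i0 - i)%N.
    by rewrite [RHS](big_nat_widen 0 i0 n)// ltnW.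
  rewrite big_nat_rev/= big_add1/=.
  apply: eq_big_nat => i ii.
  by have -> : (i0 - (0 + i0 - i.+1) = i.+1)%N by lia.
rewrite (eq_bigr (fun j : 'I_n => b (j - i0)%N)) => [|j _]; last by rewrite /rho eqxx.
rewrite -(big_mkord (fun i => i0 < i)%N (fun i => b (i - i0)%N)).
have -> : hook_weight (n - i0) = \prod_(1 <= k < n - i0) b k.
  by case: (n - i0)%N (subn_gt0 i0 n) => //; rewrite i0n.
rewrite (@big_cat_nat _ _ _ i0.+1)//= big_nat_cond big1 ?mul1r => [|i]; last by lia.
rewrite -{1}[i0.+1]add1n big_addn big_nat_cond [RHS]big_nat_cond.
by apply: eq_big => [i|i _]; [lia|rewrite addnK].
Qed.

(** With m = n - s, the factorials contribute (2m)! / (2m-1)! = 2m, which completes the first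
    product of [prod_lowered_differences] to e_m. *)
Lemma det_inv_fact_sub_lowered n s : (0 < s < n)%N ->
  \det (\matrix_(i < n, j < n) inv_fact_sub (lowered_exponent (n - s) i) j)
  = \det (\matrix_(i < n, j < n) inv_fact_sub i.*2 j) * (hook_weight s * hook_weight (n - s)).
Proof.
move=> /andP[s0 sn]; rewrite !det_inv_fact_sub prod_lowered_differences ?subKn; try lia.
have ns : (n - s < n)%N by lia.
rewrite [X in X * _](_ : _ = (\prod_(i < n) (i.*2)`!%:R^-1) * (n - s).*2%:R).
  by rewrite (hook_weight_odd (n - s)); ring.
rewrite [LHS](bigD1 (Ordinal ns))//= [X in _ = X * _](bigD1 (Ordinal ns))//=.
rewrite mulrAC; congr (_ * _); last first.
  apply: eq_bigr => i; rewrite -val_eqE /lowered_exponent /= => /negbTE ->; rewrite //.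
rewrite /lowered_exponent eqxx.
have -> : ((n - s).*2 = (n - s).*2.-1.+1)%N by lia.
by rewrite factS natrM invfM mulrAC mulVf ?mul1r// pnatr_eq0.
Qed.

Lemma det_inv_fact_sub_neq0 n :
  \det (\matrix_(i < n, j < n) (inv_fact_sub i.*2 j : F)) != 0.
Proof.
rewrite det_inv_fact_sub mulf_neq0//; apply/prodf_neq0 => i _.
  by rewrite invr_eq0 pnatr_eq0 -lt0n fact_gt0.
apply/prodf_neq0 => j ij.
by rewrite subr_eq0 eqr_nat; lia.
Qed.
End LeadingCoefficients.

(** * Counting words by divided differences *)

Section Degree.
Variable F : numFieldType.
Implicit Types (x y : nat -> F) (f g : (nat -> F) -> F) (r k p q n d e : nat).

(* Polynomial functions of degree < d, up to equality at injective points (where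
   [divdiff] is the divided difference). *)
Inductive deg_lt : nat -> ((nat -> F) -> F) -> Prop :=
| deg_lt_zero d : deg_lt d (fun=> 0)
| deg_lt_cst d c : deg_lt d.+1 (fun=> c)
| deg_lt_add d f g : deg_lt d f -> deg_lt d g -> deg_lt d (fun x => f x + g x)
| deg_lt_coord d f i : deg_lt d f -> deg_lt d.+1 (fun x => x i * f x)
| deg_lt_ext d f g : (forall x, injective x -> f x = g x) -> deg_lt d f -> deg_lt d g.

Lemma deg_lt_mono d e f : (d <= e)%N -> deg_lt d f -> deg_lt e f.
Proof.
move=> de df; elim: df e de => {d f} [d|d c|d f g _ IHf _ IHg|d f i _ IH|d f g fg _ IH] [|e]//;
  try by constructor.
- by move=> de; apply: deg_lt_add; [apply: IHf|apply: IHg].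
- by move=> de; apply: deg_lt_add; [apply: IHf|apply: IHg].
- by move=> de; apply: deg_lt_coord; apply: IH.
- by move=> /IH; apply: deg_lt_ext.
- by move=> /IH; apply: deg_lt_ext.
Qed.

Lemma deg_lt_scale d f c : deg_lt d f -> deg_lt d (fun x => c * f x).
Proof.
elim=> {d f} [d|d a|d f g _ IHf _ IHg|d f i _ IH|d f g fg _ IH].
- by apply: (deg_lt_ext _ (deg_lt_zero d)) => x _; rewrite mulr0.
- exact: deg_lt_cst.
- by apply: (deg_lt_ext _ (deg_lt_add IHf IHg)) => x _; rewrite mulrDr.
- by apply: (deg_lt_ext _ (deg_lt_coord i IH)) => x _; rewrite mulrCA.
- by apply: (deg_lt_ext _ IH) => x xI; rewrite fg.
Qed.

Lemma deg_lt0 f x : deg_lt 0 f -> injective x -> f x = 0.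
Proof.
suff gen d : deg_lt d f -> d = 0%N -> injective x -> f x = 0 by move/gen; exact.
elim=> {d f} // [d f g _ IHf _ IHg|d f g fg _ IH] d0 xI.
  by rewrite IHf// IHg// addr0.
by rewrite -fg// IH.
Qed.

Lemma deg_lt_divdiff d f r : deg_lt d f -> deg_lt d.-1 (divdiff r f).
Proof.
elim=> {d f} [d|d c|d f g _ IHf _ IHg|d f i df IH|d f g fg _ IH].
- by apply: (deg_lt_ext _ (deg_lt_zero _)) => x _; rewrite /divdiff subrr mul0r.
- by apply: (deg_lt_ext _ (deg_lt_zero _)) => x _; rewrite /divdiff subrr mul0r.
- apply: (deg_lt_ext _ (deg_lt_add IHf IHg)) => x _.
  by rewrite /divdiff -mulrDl; congr (_ * _); ring.
- case: d df IH => [|d] df IH /=.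
    apply: (deg_lt_ext _ (deg_lt_zero _)) => x xI; rewrite /divdiff !(deg_lt0 df)//.
      by rewrite !mulr0 subrr mul0r.
    exact: swap_coords_inj.
  (* Twisted Leibniz rule d_r (x_i f) = c f + x_j d_r f, where c = d_r x_i and j is the image of i
     under the swap. *)
  pose c : F := (i == r)%:R - (i == r.+1)%:R.
  pose j := if i == r then r.+1 else if i == r.+1 then r else i.
  apply: (deg_lt_ext _ (deg_lt_add (deg_lt_scale c df) (deg_lt_coord j IH))) => x xI.
  have xr : x r - x r.+1 != 0 by rewrite subr_eq0; apply/eqP => /xI; lia.
  have -> : x j = swap_coords r x i by rewrite /j /swap_coords; case: eqP => // _; case: eqP.
  rewrite /divdiff [x i](_ : _ = swap_coords r x i + c * (x r - x r.+1)).
    by field.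
  rewrite /c /swap_coords; case: eqP => [->|_].
    by rewrite ltn_eqF// subr0 mul1r addrC subrK.
  case: eqP => [->|_]; first by rewrite sub0r mulN1r opprB addrC subrK.
  by rewrite subrr mul0r addr0.
- apply: (deg_lt_ext _ IH) => x xI; rewrite /divdiff !fg//; exact: swap_coords_inj.
Qed.

Lemma deg_lt_divdiff_sum d f n : deg_lt d f -> deg_lt d.-1 (divdiff_sum n f).
Proof.
move=> df; rewrite /divdiff_sum; elim: (index_iota 1 n) => [|s l IH].
  by apply: (deg_lt_ext _ (deg_lt_zero _)) => x _; rewrite big_nil.
apply: (deg_lt_ext _ (deg_lt_add (deg_lt_divdiff s.-1 df) IH)) => x _.
by rewrite big_cons.
Qed.

Lemma deg_lt_iter_divdiff_sum d f n k :
  deg_lt d f -> deg_lt (d - k) (iter k (divdiff_sum n) f).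
Proof.
move=> df; elim: k => [|k IH]; first by rewrite subn0.
by rewrite subnS; apply: deg_lt_divdiff_sum.
Qed.

Lemma divdiffB r f g x : divdiff r (fun y => f y - g y) x = divdiff r f x - divdiff r g x.
Proof. by rewrite /divdiff -mulrBl; congr (_ * _); ring. Qed.

Lemma iter_divdiff_sumB n k f g x :
  iter k (divdiff_sum n) (fun y => f y - g y) x
  = iter k (divdiff_sum n) f x - iter k (divdiff_sum n) g x.
Proof.
elim: k x => // k IH x; rewrite !iterS /divdiff_sum -sumrB; apply: eq_bigr => s _.
by rewrite -divdiffB /divdiff !IH.
Qed.

Lemma deg_lt_prod_coord (s : seq (nat * nat)) :
  deg_lt (size s).+1 (fun y => \prod_(p <- s) y p.1).
Proof.
elim: s => [|p s IH]; first by apply: deg_lt_ext (deg_lt_cst 0 1) => y _; rewrite big_nil.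
by apply: deg_lt_ext (deg_lt_coord p.1 IH) => y _; rewrite big_cons.
Qed.

Lemma deg_lt_prod_coord_sub (s : seq (nat * nat)) :
  deg_lt (size s) (fun y => \prod_(p <- s) (y p.1 - p.2%:R) - \prod_(p <- s) y p.1).
Proof.
elim: s => [|p s IH].
  by apply: deg_lt_ext (deg_lt_zero _) => y _; rewrite !big_nil subrr.
have IH' := deg_lt_mono (leqnSn _) IH.
have := deg_lt_scale (- p.2%:R) (deg_lt_add IH' (deg_lt_prod_coord s)).
move/(deg_lt_add (deg_lt_coord p.1 IH)); apply: deg_lt_ext => y _.
by rewrite !big_cons; ring.
Qed.

(* Has leading form x^delta and, unlike x^delta, vanishes at all permutations of the point
   (0, 1, ..., n - 1) except the reversed one. *)
Definition staircase_poly n y : F :=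
  \prod_(0 <= i < n) \prod_(0 <= j < n - i.+1) (y i - j%:R).

Lemma deg_lt_staircase_poly n :
  deg_lt 'C(n, 2) (fun y => staircase_poly n y - \prod_(i < n) y i ^+ (n - i.+1)).
Proof.
pose s := [seq (i, j) | i <- iota 0 n, j <- iota 0 (n - i.+1)].
have -> : 'C(n, 2) = size s.
  rewrite size_allpairs_dep sumnE big_map -bin2_sum.
  under [RHS]eq_bigr do rewrite size_iota.
  have -> : iota 0 n = index_iota 0 n by rewrite /index_iota subn0.
  rewrite big_nat_rev.
  by apply: eq_big_nat => i /andP[_ ?]; lia.
apply: deg_lt_ext (deg_lt_prod_coord_sub s) => y _.
rewrite !big_allpairs_dep /= /staircase_poly /index_iota !subn0; congr (_ - _).
  by apply: eq_bigr => i _; rewrite subn0.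
rewrite -(big_mkord xpredT (fun i => y i ^+ (n - i.+1))) /index_iota subn0.
apply: eq_bigr => i _; rewrite big_const_seq count_predT size_iota.
by rewrite -Monoid.iteropE.
Qed.

(** The difference of the two polynomials has degree below N = ['C(n, 2)], and each application of D
    lowers the degree by one. *)
Lemma iter_divdiff_sum_staircase_poly n k x : injective x -> ('C(n, 2) <= k)%N ->
  iter k (divdiff_sum n) (staircase_poly n) x
  = iter k (divdiff_sum n) (fun y => \prod_(i < n) y i ^+ (n - i.+1)) x.
Proof.
move=> xI nk; apply/eqP; rewrite -subr_eq0 -iter_divdiff_sumB; apply/eqP.
apply: deg_lt0 xI; have -> : 0%N = ('C(n, 2) - k)%N by lia.
exact/deg_lt_iter_divdiff_sum/deg_lt_staircase_poly.
Qed.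

Lemma divdiff_iter_staircase_poly n r x : injective x ->
  divdiff r (iter 'C(n, 2).-1 (divdiff_sum n) (staircase_poly n)) x
  = divdiff r (iter 'C(n, 2).-1 (divdiff_sum n) (fun y => \prod_(i < n) y i ^+ (n - i.+1))) x.
Proof.
move=> xI; apply/eqP; rewrite -subr_eq0 -divdiffB; apply/eqP.
apply: deg_lt0 xI.
have /(deg_lt_divdiff r) := deg_lt_iter_divdiff_sum n 'C(n, 2).-1 (deg_lt_staircase_poly n).
have -> : ('C(n, 2) - 'C(n, 2).-1).-1 = 0%N by lia.
apply: deg_lt_ext => y _.
by rewrite /divdiff !iter_divdiff_sumB.
Qed.
End Degree.

(** * Coinversions and evaluation at permuted points *)

Section Permutations.
Variable n : nat.
Implicit Types (v : 'S_n).

Lemma adjacent_transpositionE s (i j : 'I_n) :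
  i = s.-1 :> nat -> j = s :> nat -> adjacent_transposition n s = tperm i j.
Proof.
by move=> si sj; rewrite /adjacent_transposition -si -sj !valK.
Qed.

Lemma adjacent_transpositionK s : (adjacent_transposition n s * adjacent_transposition n s = 1)%g.
Proof.
rewrite /adjacent_transposition; case: insub => [i|]; last by rewrite mulg1.
by case: insub => [j|]; [exact: tperm2|rewrite mulg1].
Qed.

Definition pair_lt : pred ('I_n * 'I_n) := fun p => (p.1 < p.2)%N.

(* Pairs are pairs of values, so that multiplication by an adjacent transposition
   changes the status of a single pair. *)
Definition coinv_pair v : pred ('I_n * 'I_n) := fun p => (v^-1%g p.1 < v^-1%g p.2)%N.

Definition coinversions v : nat := \sum_(p | pair_lt p) coinv_pair v p.

Lemma coinv_pair_tperm v (i j : 'I_n) p : j = i.+1 :> nat -> (v i < v j)%N ->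
  pair_lt p ->
  coinv_pair (tperm i j * v)%g p = coinv_pair v p && (p != (v i, v j)).
Proof.
move=> ij vij; case: p => a b; rewrite /pair_lt /coinv_pair /= => ab.
rewrite invMg !permM tpermV xpair_eqE.
have [vi vj] : v^-1%g (v i) = i /\ v^-1%g (v j) = j by rewrite !permK.
have Ea : a = v (v^-1%g a) by rewrite permKV.
have Eb : b = v (v^-1%g b) by rewrite permKV.
rewrite {3}Ea {3}Eb !(inj_eq perm_inj); move: Ea Eb.
move: (v^-1%g a) (v^-1%g b) => p q Ea Eb.
case: tpermP => [?|?|/eqP pi /eqP pj]; case: tpermP => [?|?|/eqP qi /eqP qj]; subst;
  rewrite ?eqxx ?andbT ?andbF /= -?val_eqE /= in ab vij *; try lia.
- by move: qi qj; rewrite -!val_eqE /=; lia.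
- by move: pi pj; rewrite -!val_eqE /=; lia.
- by rewrite val_eqE (negbTE pi) andbT.
Qed.

Lemma coinversions_tperm v (i j : 'I_n) : j = i.+1 :> nat -> (v i < v j)%N ->
  coinversions v = (coinversions (tperm i j * v)%g).+1.
Proof.
move=> ij vij; rewrite /coinversions (bigD1 (v i, v j))//= [in RHS](bigD1 (v i, v j))//=.
rewrite (coinv_pair_tperm ij vij)// eqxx andbF add0n -add1n; congr (_ + _)%N.
  by rewrite /coinv_pair/= !permK ij ltnSn.
apply: eq_bigr => p /andP[pp pne]; rewrite (coinv_pair_tperm ij vij)// pne andbT //.
Qed.

(** The product, up to sign, of the denominators met on a shortest way from v to the reverse
    permutation: each coinversion is undone once, whatever the word. *)
Definition coinv_gap_prod v : nat :=
  \prod_(p | pair_lt p) (if coinv_pair v p then p.2 - p.1 else 1).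

Lemma coinv_gap_prod_tperm v (i j : 'I_n) : j = i.+1 :> nat -> (v i < v j)%N ->
  coinv_gap_prod v = ((v j - v i) * coinv_gap_prod (tperm i j * v)%g)%N.
Proof.
move=> ij vij; rewrite /coinv_gap_prod (bigD1 (v i, v j))//= [in RHS](bigD1 (v i, v j))//=.
rewrite (coinv_pair_tperm ij vij)// eqxx andbF mul1n; congr (_ * _)%N.
  by rewrite /coinv_pair/= !permK ij ltnSn.
apply: eq_bigr => p /andP[pp pne]; rewrite (coinv_pair_tperm ij vij)// pne andbT //.
Qed.

Lemma coinv_pair_reverse p : pair_lt p -> coinv_pair (reverse_permutation n) p = false.
Proof.
rewrite /pair_lt /coinv_pair => pp.
have -> : ((reverse_permutation n)^-1 = reverse_permutation n)%g.
  by apply/eqP; rewrite eq_invg_mul; apply/eqP/permP => i; rewrite permM !permE rev_ordK.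
rewrite !permE /=; case: p pp => a b /=; have := ltn_ord a; have := ltn_ord b; lia.
Qed.

Lemma coinversions_reverse : coinversions (reverse_permutation n) = 0%N.
Proof. by rewrite /coinversions big1// => p pp; rewrite coinv_pair_reverse. Qed.

Lemma coinv_gap_prod_reverse : coinv_gap_prod (reverse_permutation n) = 1%N.
Proof. by rewrite /coinv_gap_prod big1// => p pp; rewrite coinv_pair_reverse. Qed.

Lemma coinversions1 : coinversions 1 = 'C(n, 2).
Proof.
rewrite -sum_ord_bin2 /coinversions -(pair_big_dep xpredT (fun i j : 'I_n => (i < j)%N)
  (fun i j => coinv_pair 1 (i, j) : nat)) /=.
rewrite (exchange_big_dep xpredT)//=; apply: eq_bigr => j _.
rewrite (eq_bigr (fun=> 1%N)) => [|i ij]; last by rewrite /coinv_pair/= invg1 !perm1 ij.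
rewrite -(big_mkord (fun i => (i < j)%N) (fun=> 1%N)).
have -> : \sum_(0 <= i < n | (i < j)%N) 1%N = (\sum_(0 <= i < j) 1)%N.
  by rewrite [RHS](big_nat_widen 0 j n)// ltnW.
by rewrite big_const_nat iter_addn_0 mul1n subn0.
Qed.

(** Arranged to match the factors of [staircase_poly] at the reversed point. *)
Lemma coinv_gap_prod1 :
  coinv_gap_prod 1 = (\prod_(0 <= i < n) \prod_(0 <= j < n - i.+1) (n - i.+1 - j))%N.
Proof.
rewrite /coinv_gap_prod.
rewrite -(pair_big_dep xpredT (fun i j : 'I_n => (i < j)%N)
  (fun i j => if coinv_pair 1 (i, j) then (j - i)%N else 1%N)) /=.
rewrite (exchange_big_dep xpredT)//= big_nat_rev big_mkord; apply: eq_bigr => j _.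
have -> : (n - (0 + n - j.+1).+1 = j)%N by have := ltn_ord j; lia.
rewrite (eq_bigr (fun i : 'I_n => (j - i)%N)) => [|i ij]; last by rewrite /coinv_pair/= invg1 !perm1 ij.
rewrite -(big_mkord (fun i => (i < j)%N) (fun i => j - i)%N).
by rewrite [RHS](big_nat_widen 0 j n)// ltnW.
Qed.

(* The number of words w of length k such that v followed by w reaches the reverse
   permutation. *)
Fixpoint completions k v : nat :=
  if k is k'.+1 then \sum_(1 <= s < n) completions k' (adjacent_transposition n s * v)%g
  else (v == reverse_permutation n).

Variable F : numFieldType.

(* Extended by the identity beyond n in order to be injective on all of nat. *)
Definition perm_point v : nat -> F :=
  fun i => (if insub i is Some j then v j : nat else i)%:R.

Lemma perm_pointE v (i : 'I_n) : perm_point v i = (v i)%:R.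
Proof. by rewrite /perm_point valK. Qed.

Lemma perm_point_inj v : injective (perm_point v).
Proof.
move=> i j; rewrite /perm_point; case: insubP => [a ia <-|ia]; case: insubP => [b jb <-|jb].
- by move/eqP; rewrite eqr_nat val_eqE (inj_eq perm_inj) => /eqP ->.
- move/eqP; rewrite eqr_nat => /eqP E; have := ltn_ord (v a); lia.
- move/eqP; rewrite eqr_nat => /eqP E; have := ltn_ord (v b); lia.
- by move/eqP; rewrite eqr_nat => /eqP.
Qed.

Lemma swap_coords_perm_point v (i j : 'I_n) : j = i.+1 :> nat ->
  swap_coords i (perm_point v) = perm_point (tperm i j * v)%g.
Proof.
move=> ij; apply: boolp.funext => k; rewrite /swap_coords -ij.
case: eqP => [->|ki]; first by rewrite !perm_pointE permM tpermL.
case: eqP => [->|kj]; first by rewrite !perm_pointE permM tpermR.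
rewrite /perm_point; case: insubP => // a _ ak.
by rewrite permM tpermD//; apply/eqP => E; [apply: ki|apply: kj]; rewrite -ak E.
Qed.

(** If v i >= n - 1 - i for all i, equality holds throughout because the sums over i agree, and v is
    the reverse permutation. Otherwise some v i is a root of one of the factors. *)
Lemma staircase_poly_perm_point0 v : v != reverse_permutation n ->
  staircase_poly n (perm_point v) = 0.
Proof.
move=> vr.
have [i vi] : exists i : 'I_n, (v i < n - i.+1)%N.
  apply/existsP; apply: contraNT vr; rewrite negb_exists => /forallP vge.
  have ge i : (rev_ord i <= v i ?= iff (rev_ord i == v i :> nat))%N.
    by split=> //; have := vge i; rewrite -leqNgt.
  have [_] := leqif_sum (fun i (_ : predT i) => ge i).
  rewrite [X in X == _](_ : _ = \sum_(i < n) i)%N; last first.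
    by rewrite [RHS](reindex_inj rev_ord_inj).
  rewrite [X in X == _](_ : _ = \sum_(i < n) v i)%N; last first.
    by rewrite [LHS](reindex_inj (@perm_inj _ v)).
  rewrite eqxx => /esym/forallP E; apply/eqP/permP => i; apply/val_inj.
  by have := E i; rewrite /= permE => /eqP.
rewrite /staircase_poly big_mkord (bigD1 i)//= [X in X * _](_ : _ = 0) ?mul0r//.
rewrite big_mkord (bigD1 (Ordinal vi))//= perm_pointE subrr mul0r //.
Qed.

Lemma staircase_poly_reverse :
  staircase_poly n (perm_point (reverse_permutation n)) = (coinv_gap_prod 1)%:R.
Proof.
rewrite coinv_gap_prod1 /staircase_poly natr_prod !big_mkord; apply: eq_bigr => i _.
rewrite natr_prod; apply: eq_big_nat => j /andP[_ jn].
by rewrite perm_pointE permE /= -natrB ?(ltnW jn).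
Qed.

Local Notation D := (divdiff_sum n).
Local Notation g := (@staircase_poly F n).

(* Expanding the divided differences at v evaluates [staircase_poly] at the products of v
   with subwords; only full words that reach the reverse permutation contribute. *)
Lemma iter_divdiff_sum_perm_point k v :
  ((k < coinversions v)%N -> iter k D g (perm_point v) = 0 /\ completions k v = 0%N) /\
  (k = coinversions v -> iter k D g (perm_point v) * (coinv_gap_prod v)%:R
     = (completions k v)%:R * g (perm_point (reverse_permutation n))).
Proof.
elim: k v => [|k IH] v.
  rewrite /completions; case: eqP => [->|/eqP vr].
    by rewrite coinversions_reverse coinv_gap_prod_reverse mulr1 mul1r.
  by rewrite mul0r /= staircase_poly_perm_point0// mul0r.
have term s : (0 < s < n)%N -> (k < coinversions v)%N ->
  let v' := (adjacent_transposition n s * v)%g in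
  ((k.+1 < coinversions v)%N -> divdiff s.-1 (iter k D g) (perm_point v) = 0
    /\ completions k v' = 0%N) /\
  (k.+1 = coinversions v -> divdiff s.-1 (iter k D g) (perm_point v) * (coinv_gap_prod v)%:R
     = (completions k v')%:R * g (perm_point (reverse_permutation n))).
  move=> /andP[s0 sn] kv /=.
  have s1n : (s.-1 < n)%N by lia.
  pose i := Ordinal s1n; pose j := Ordinal sn.
  have ij : j = i.+1 :> nat by rewrite /= prednK.
  rewrite (adjacent_transpositionE (i := i) (j := j))//.
  rewrite /divdiff -[s.-1]/(i : nat) (swap_coords_perm_point v ij) -ij.
  (* The unswapped point has more than k coinversions, so its term vanishes by induction. *)
  rewrite (proj1 (proj1 (IH v) kv)) sub0r !perm_pointE.
  (* Swapping an ascent removes one coinversion and brings the denominator v j - v i; swapping a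
     descent adds a coinversion, and both sides are 0. *)
  have [vij|vij|/val_inj/perm_inj E] := ltngtP (v i) (v j).
  - have cE := coinversions_tperm ij vij; have [IH1 IH2] := IH (tperm i j * v)%g.
    split=> [kv'|kv'].
      by have [-> ->] := IH1 ltac:(lia); rewrite oppr0 mul0r.
    rewrite -(IH2 ltac:(lia)) (coinv_gap_prod_tperm ij vij) natrM natrB ?(ltnW vij)//.
    rewrite -[X in _ / X]opprB invrN mulrNN mulrA divfK//.
    by rewrite subr_eq0 eqr_nat; lia.
  - have cE : coinversions (tperm i j * v)%g = (coinversions v).+1.
      rewrite (@coinversions_tperm _ i j ij) ?permM ?tpermL ?tpermR//.
      by rewrite mulgA tperm2 mul1g.
    have [IH1 _] := IH (tperm i j * v)%g.
    by have [-> ->] := IH1 ltac:(lia); rewrite oppr0 !mul0r.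
  - by move: ij; rewrite E; lia.
split=> kv.
  split; rewrite /= /divdiff_sum big_nat big1// => s sn.
    by have [/(_ kv)[]] := term s sn (ltnW kv).
  by have [/(_ kv)[]] := term s sn (ltnW kv).
rewrite /= /divdiff_sum natr_sum !mulr_suml; apply: eq_big_nat => s sn.
by have [_ ->] := term s sn ltac:(lia).
Qed.
End Permutations.

(** * The number of networks, in total and with a given first swap *)

Section Counting.
Variables (F : numFieldType) (n : nat).
Local Notation N := 'C(n, 2).
Local Notation D := (divdiff_sum n).
Local Notation g := (@staircase_poly F n).
Local Notation g0 := (fun y : nat -> F => \prod_(i < n) y i ^+ (n - i.+1)).
Local Notation x1 := (@perm_point n F 1).

Lemma coinv_gap_prod_neq0 (v : 'S_n) : (coinv_gap_prod v)%:R != 0 :> F.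
Proof.
rewrite pnatr_eq0 -lt0n; apply: prodn_cond_gt0 => -[a b]; rewrite /pair_lt/= => ab.
by case: ifP; rewrite // subn_gt0.
Qed.

Lemma iter_divdiff_sum_monomial k x : injective x ->
  iter k D g0 x = (\det (staircase_mx n x))`_k *+ k`!.
Proof.
move=> xI; rewrite -iter_divdiff_sum_staircase//; elim: k x xI => [|k IH] x xI /=.
  by rewrite staircase_coef0.
exact: eq_divdiff_sum.
Qed.

(** D^N at the identity point, evaluated by words and by the determinant. The product of gaps equals
    the value of [staircase_poly] at the reversed point and cancels. *)
Lemma completions_full :
  (completions N (1 : 'S_n))%:R
  = N`!%:R * \det (\matrix_(i < n, j < n) inv_fact_sub F i.*2 j).
Proof.
have x1I : injective x1 by exact: perm_point_inj.
have [_ /(_ (esym (coinversions1 n)))] := iter_divdiff_sum_perm_point F N (1 : 'S_n).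
rewrite staircase_poly_reverse => /(mulIf (coinv_gap_prod_neq0 _)) <-.
rewrite iter_divdiff_sum_staircase_poly// -(coef_staircase _ x1) mulr_natl.
by rewrite iter_divdiff_sum_monomial.
Qed.

Lemma completions_first s : (0 < s < n)%N ->
  (completions N.-1 (adjacent_transposition n s))%:R
  = N.-1`!%:R * \det (\matrix_(i < n, j < n) inv_fact_sub F (lowered_exponent (n - s) i) j).
Proof.
move=> sn; have /andP[s0 ltsn] := sn.
have x1I : injective x1 by exact: perm_point_inj.
have s1n : (s.-1 < n)%N by lia.
pose i := Ordinal s1n; pose j := Ordinal ltsn.
have ij : j = i.+1 :> nat by rewrite /= prednK.
have vij : ((1 : 'S_n)%g i < (1 : 'S_n)%g j)%N by rewrite !perm1 /= prednK.
have at_s : adjacent_transposition n s = (tperm i j * 1)%g.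
  by rewrite mulg1; apply: adjacent_transpositionE.
have cE := coinversions_tperm ij vij; rewrite coinversions1 in cE.
have N0 : (N.-1 < coinversions (1 : 'S_n))%N by rewrite coinversions1 cE.
(* D^{N-1} of [staircase_poly] vanishes at the identity point, which has N coinversions, so that d_s
   retains only the swapped point. *)
have [E1 _] := proj1 (iter_divdiff_sum_perm_point F N.-1 (1 : 'S_n)) N0.
have [_ /(_ _)] := iter_divdiff_sum_perm_point F N.-1 (tperm i j * 1)%g.
rewrite {1}cE => /(_ erefl) E2.
rewrite at_s -(coef_staircase_lowered x1)// -divdiff_staircase//.
rewrite mulr_natl.
have <- : divdiff s.-1 (iter N.-1 D g) x1
    = divdiff s.-1 (fun y => (\det (staircase_mx n y))`_N.-1) x1 *+ N.-1`!.
  rewrite divdiff_iter_staircase_poly// /divdiff -mulrnAl mulrnBl.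
  by rewrite !iter_divdiff_sum_monomial//; apply: swap_coords_inj.
rewrite /divdiff E1 sub0r -[s.-1]/(i : nat) (swap_coords_perm_point F _ ij) -ij.
rewrite !perm_pointE !perm1.
move: E2; rewrite staircase_poly_reverse (coinv_gap_prod_tperm ij vij) natrM !perm1.
have -> : (j - i = 1)%N by rewrite ij subSnn.
rewrite mul1r => /(mulIf (coinv_gap_prod_neq0 _)) ->.
by rewrite ij -natr1 opprD addrA subrr sub0r invrN invr1 mulrN mulr1 opprK.
Qed.

(** This is P(s_1 = s) = e_s e_{n-s} / N, cleared of denominators. *)
Theorem completions_ratio s : (0 < s < n)%N ->
  N%:R * (completions N.-1 (adjacent_transposition n s))%:R
  = (completions N (1 : 'S_n))%:R * (hook_weight F s * hook_weight F (n - s)).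
Proof.
move=> sn; rewrite completions_first// completions_full det_inv_fact_sub_lowered//.
have N0 : (0 < N)%N by rewrite bin_gt0; lia.
by rewrite -[in N`!](prednK N0) factS (prednK N0) natrM; ring.
Qed.

Lemma completions_full_neq0 : completions N (1 : 'S_n) != 0%N.
Proof.
rewrite -(@pnatr_eq0 F) completions_full.
by rewrite mulf_neq0 ?det_inv_fact_sub_neq0// pnatr_eq0 -lt0n fact_gt0.
Qed.
End Counting.

(** * Sorting networks as words *)

(** Lists the words counted by [completions], so that uniform probabilities become counts in a
    list. *)
Fixpoint network_suffixes n k (v : 'S_n) : seq (k.-tuple nat) :=
  match k with
  | 0 => if v == reverse_permutation n then [:: [tuple]] else [::]
  | k'.+1 => [seq cons_tuple s w | s <- iota 1 n.-1,
                w <- network_suffixes k' (adjacent_transposition n s * v)%g]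
  end.

Lemma mem_network_suffixes n k (v : 'S_n) (w : k.-tuple nat) :
  (w \in network_suffixes k v) =
  all (fun s => 0 < s < n)%N w
  && ((compose_transpositions n w * v)%g == reverse_permutation n).
Proof.
elim: k v w => [|k IH] v w.
  case: w => -[|//] sz /=; rewrite mul1g.
  by case: eqP => // _; rewrite inE; apply/eqP/val_inj.
case/tupleP: w => s w /=.
have -> : (compose_transpositions n (s :: w) * v
    = compose_transpositions n w * (adjacent_transposition n s * v))%g.
  by rewrite mulgA.
apply/allpairsPdep/idP => [[t [u [tn]]]|/andP[/andP[/andP[s0 sn] wn] E]].
  rewrite IH => /andP[un E] [-> wu]; have -> : w = u by apply: val_inj.
  by rewrite un E andbT; move: tn; rewrite mem_iota; lia.
exists s, w; split=> //; first by rewrite mem_iota; lia.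
by rewrite IH wn.
Qed.

Lemma size_network_suffixes n k (v : 'S_n) :
  size (network_suffixes k v) = completions k v.
Proof.
elim: k v => [|k IH] v /=; first by case: eqP.
rewrite size_allpairs_dep sumnE big_map /index_iota subn1.
by apply: eq_bigr => s _; exact: IH.
Qed.

Lemma uniq_network_suffixes n k (v : 'S_n) : uniq (network_suffixes k v).
Proof.
elim: k v => [|k IH] v /=; first by case: eqP.
apply: allpairs_uniq_dep => [|s _|[s w] [t u] _ _ /= [-> wu]]; rewrite ?iota_uniq//.
by congr existT; apply: val_inj.
Qed.

Lemma count_network_suffixes n k (v : 'S_n) s : (0 < k)%N ->
  count (fun w => swap_location 1 w == s) (network_suffixes k v)
  = if (0 < s < n)%N then completions k.-1 (adjacent_transposition n s * v)%g else 0%N.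
Proof.
case: k => // k _ /=; rewrite count_flatten -map_comp sumnE big_map.
have count1 t : count (fun w => swap_location 1 w == s)
    [seq cons_tuple t w | w <- network_suffixes k (adjacent_transposition n t * v)%g]
    = if t == s then completions k (adjacent_transposition n t * v)%g else 0%N.
  rewrite count_map -size_network_suffixes; set l := network_suffixes _ _.
  by case: eqP => ts; [rewrite -[RHS]count_predT|rewrite -[RHS](count_pred0 l)];
    apply: eq_count => w; rewrite /swap_location /=; apply/eqP.
under eq_bigr do rewrite /= count1.
rewrite -big_mkcond /=; case: ifPn => sn; last first.
  rewrite big_seq_cond big1// => t /andP[]; rewrite mem_iota => tn /eqP ts; lia.
by rewrite -big_filter filter_pred1_uniq ?iota_uniq ?mem_iota ?big_seq1//; lia.
Qed.

Definition networks n := network_suffixes 'C(n, 2) (1 : 'S_n).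

Lemma sorting_networksE n : sorting_networks n = [set` networks n].
Proof.
apply/seteqP; split=> w /=; rewrite /sorting_networks /is_sorting_network /=;
  by rewrite mem_network_suffixes mulg1.
Qed.

Definition rotate_network n (m : nat) (w : m.-tuple nat) : m.-tuple nat :=
  [tuple if i == 0%N :> nat then (n - nth 0 w m.-1)%N else nth 0%N w i.-1 | i < m].

Lemma omit_first_rotate n m (w : m.-tuple nat) :
  omit_first (rotate_network n w) = omit_last w.
Proof.
apply: eq_from_tnth => i; rewrite !tnth_mktuple /swap_location /=.
have im : (i.+1 < m)%N by have := ltn_ord i; lia.
rewrite -[i.+1]/(val (Ordinal im)) -(tnth_nth 0%N (rotate_network n w)).
by rewrite tnth_mktuple.
Qed.

Lemma tuple_rconsP (T : Type) m (w : m.+1.-tuple T) :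
  exists (u : m.-tuple T) s, w = [tuple of rcons u s].
Proof.
exists [tuple of belast (thead w) (behead w)], (last (thead w) (behead w)).
by apply: val_inj; rewrite /= -lastI; case/tupleP: w => a w /=; rewrite theadE.
Qed.

Lemma reverse_permutationK n : (reverse_permutation n * reverse_permutation n = 1)%g.
Proof. by apply/permP => i; rewrite permM !permE rev_ordK. Qed.

Lemma rotate_rcons n m s (u : m.-tuple nat) :
  rotate_network n [tuple of rcons u s] = [tuple of (n - s)%N :: u].
Proof.
apply: eq_from_tnth => i; rewrite tnth_mktuple (tnth_nth 0%N) /=.
case: i => -[|i] im /=; first by rewrite nth_rcons size_tuple ltnn eqxx.
by rewrite nth_rcons size_tuple -ltnS im.
Qed.

Lemma adjacent_transposition_reverse n s : (0 < s < n)%N ->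
  (reverse_permutation n * adjacent_transposition n (n - s) * reverse_permutation n
   = adjacent_transposition n s)%g.
Proof.
move=> /andP[s0 sn].
have s1n : (s.-1 < n)%N by lia.
have rK : ((reverse_permutation n)^-1 = reverse_permutation n)%g.
  by apply/eqP; rewrite eq_invg_mul reverse_permutationK.
have ns : (n - s < n)%N by lia.
have ns1 : ((n - s).-1 < n)%N by lia.
rewrite (@adjacent_transpositionE _ s (Ordinal s1n) (Ordinal sn))//.
rewrite (@adjacent_transpositionE _ (n - s) (Ordinal ns1) (Ordinal ns))//.
rewrite -{1}rK -mulgA -conjgE tpermJ !permE tpermC; congr tperm; apply: val_inj => /=; lia.
Qed.

Lemma rotate_network_in n w : w \in networks n -> rotate_network n w \in networks n.
Proof.
rewrite /networks !mem_network_suffixes !mulg1; case: 'C(n, 2) w => [|m] w.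
  by rewrite [rotate_network _ _]tuple0 [w]tuple0.
have [u [s ->]] := tuple_rconsP w.
rewrite rotate_rcons /= all_rcons => /andP[/andP[sn un] /eqP E].
have c1 : compose_transpositions n (rcons u s)
    = (adjacent_transposition n s * compose_transpositions n u)%g.
  rewrite /compose_transpositions; elim: (val u) => [|t l IH] /=; first by rewrite mul1g mulg1.
  by rewrite IH mulgA.
apply/andP; split; first by rewrite un andbT; lia.
(* The last letter is cancelled on the left; conjugation by the reverse permutation then brings it
   back on the right, as location n - s. *)
have -> : compose_transpositions n u = (adjacent_transposition n s * reverse_permutation n)%g.
  by rewrite -E c1 mulgA adjacent_transpositionK mul1g.
rewrite -(adjacent_transposition_reverse sn) -!mulgA.
rewrite (mulgA (reverse_permutation n) (reverse_permutation n)).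
rewrite reverse_permutationK mul1g adjacent_transpositionK mulg1 //.
Qed.

Lemma rotate_network_inj n : {in networks n &, injective (@rotate_network n 'C(n, 2))}.
Proof.
rewrite /networks => w w'; rewrite !mem_network_suffixes !mulg1.
case: 'C(n, 2) w w' => [|m] w w'; first by move=> _ _ _; rewrite [w]tuple0 [w']tuple0.
have [[u [s ->]] [u' [s' ->]]] := (tuple_rconsP w, tuple_rconsP w').
rewrite !rotate_rcons /= !all_rcons => /andP[/andP[sn _] _] /andP[/andP[sn' _] _].
move=> /(congr1 val)[ss uu]; apply: val_inj; rewrite /= uu; congr rcons; lia.
Qed.

(** An injection of a finite set into itself is a bijection. *)
Lemma perm_rotate_network n : perm_eq (map (@rotate_network n _) (networks n)) (networks n).
Proof.
have u : uniq (map (@rotate_network n _) (networks n)).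
  by rewrite map_inj_in_uniq ?uniq_network_suffixes//; exact: rotate_network_inj.
apply: uniq_perm => //; first exact: uniq_network_suffixes.
have sub : {subset map (@rotate_network n _) (networks n) <= networks n}.
  by move=> _ /mapP[w wn ->]; exact: rotate_network_in.
by have [] := uniq_min_size u sub; rewrite ?size_map.
Qed.

Lemma counting_seq (R : realType) (T : choiceType) (s : seq T) (A : set T) :
  uniq s -> counting (A `&` [set` s]) = ((count (fun x => x \in A) s)%:R%:E : \bar R).
Proof.
move=> us; have -> : A `&` [set` s] = [set` [fset x in [seq x <- s | x \in A]]%fset].
  apply/seteqP; split=> x /=.
    by move=> [Ax xs]; rewrite !inE mem_filter xs andbT; exact/mem_set.
  by rewrite !inE mem_filter => /andP[/set_mem ? ?]; split.
rewrite /counting asboolT; last exact: finite_fset.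
by rewrite set_fsetK card_fseq undup_id ?filter_uniq// size_filter.
Qed.

(** * Stationarity, and the distribution function of s_1 *)

Section Uniform.
Variables (R : realType) (d : measure_display) (Omega : measurableType d)
  (P : probability Omega R) (n : nat) (omega : {RV P >-> 'C(n, 2).-tuple nat}).
Hypothesis omega_uniform : uniformly_distributed omega (sorting_networks n).

Lemma uniform_network_prob (A : set ('C(n, 2).-tuple nat)) : measurable A ->
  distribution P omega A =
  ((count (fun w => w \in A) (networks n))%:R / (completions 'C(n, 2) (1 : 'S_n))%:R)%:E.
Proof.
move=> mA; rewrite omega_uniform// sorting_networksE.
have un := uniq_network_suffixes 'C(n, 2) (1 : 'S_n).
rewrite counting_seq// -[X in (_ / counting X)%E]setTI counting_seq//.
have -> : count (fun w => w \in [set: _]) (networks n) = completions 'C(n, 2) (1 : 'S_n).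
  by rewrite -size_network_suffixes -count_predT; apply: eq_count => w; rewrite in_setT.
rewrite inver.
by rewrite pnatr_eq0 (negbTE (completions_full_neq0 R n)).
Qed.

(** Rotation permutes the networks, and a rotated network without its first letter is the original
    one without its last. *)
Lemma omit_equal_in_law :
  equal_in_law (P := P) (@omit_last 'C(n, 2) \o omega) (@omit_first 'C(n, 2) \o omega).
Proof.
move=> A mA.
have mE (f : 'C(n, 2).-tuple nat -> 'C(n, 2).-1.-tuple nat) : measurable_fun setT f ->
    measurable (f @^-1` A).
  by move=> mf; rewrite -[_ @^-1` _]setTI; exact: mf.
rewrite -[LHS]/(distribution P omega (@omit_last _ @^-1` A)).
rewrite -[RHS]/(distribution P omega (@omit_first _ @^-1` A)).
rewrite uniform_network_prob; last exact: mE (@measurable_omit_last _).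
rewrite uniform_network_prob; last exact: mE (@measurable_omit_first _).
congr (_%:R / _)%:E; rewrite -[RHS](seq.permP (perm_rotate_network n)) count_map.
by apply: eq_count => w; apply/idP/idP => /set_mem h; apply/mem_set; move: h;
  rewrite /= omit_first_rotate.
Qed.

Lemma cdf_first_swap x : (2 <= n)%N ->
  cdf (P := P) (@rescale R n \o (@swap_location 'C(n, 2) 1 \o omega)) x
  = (\sum_(1 <= s < n | rescale R n s <= x)
       (hook_weight R s * hook_weight R (n - s) / ('C(n, 2))%:R))%:E.
Proof.
move=> n2; have N0 : (0 < 'C(n, 2))%N by rewrite bin_gt0.
pose A := [set w : 'C(n, 2).-tuple nat | rescale R n (swap_location 1 w) <= x].
rewrite -[LHS]/(distribution P omega A) uniform_network_prob; last first.
  rewrite -[A]setTI.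
  exact: (@measurable_nth_tuple 'C(n, 2) 0 measurableT [set s | rescale R n s <= x]).
rewrite -(eq_bigr _ (fun s _ => mulrC _ _)) -mulr_sumr.
have -> : count (fun w => w \in A) (networks n) = (\sum_(1 <= s < n | (rescale R n s <= x)%R)
    completions 'C(n, 2).-1 (adjacent_transposition n s))%N.
  (* Sort the networks by their first location. *)
  transitivity (\sum_(1 <= s < n | (rescale R n s <= x)%R)
      count (fun w => swap_location 1 w == s) (networks n))%N; last first.
    rewrite big_nat_cond [RHS]big_nat_cond; apply: eq_bigr => s /andP[sn _].
    by rewrite count_network_suffixes// sn mulg1.
  rewrite -sum1_count big_mkcond.
  under [RHS]eq_bigr do rewrite -sum1_count big_mkcond.
  rewrite exchange_big; apply: eq_big_seq => w.
  rewrite mem_network_suffixes => /andP[wn _].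
  have s1n : (0 < swap_location 1 w < n)%N.
    by apply: (allP wn); rewrite /swap_location mem_nth// size_tuple.
  rewrite -big_mkcondr.
  have -> : (w \in A) = (rescale R n (swap_location 1 w) <= x).
    by apply/idP/idP => [/set_mem|?]//; exact/mem_set.
  rewrite big_mkcondl /= -big_filter (eq_filter (a2 := pred1 (swap_location 1 w))); last first.
    by move=> s; rewrite /= eq_sym.
  by rewrite filter_pred1_uniq ?iota_uniq ?big_seq1// mem_index_iota.
congr (_%:E); rewrite natr_sum mulr_suml mulr_sumr.
rewrite big_nat_cond [RHS]big_nat_cond; apply: eq_bigr => s /andP[sn _].
have N0' : 'C(n, 2)%:R != 0 :> R by rewrite pnatr_eq0 -lt0n.
have c0 : (completions 'C(n, 2) (1 : 'S_n))%:R != 0 :> R.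
  by rewrite pnatr_eq0 (completions_full_neq0 R).
apply: (mulfI N0'); rewrite mulrA completions_ratio// mulrAC divff// mul1r.
by rewrite mulVKf.
Qed.
End Uniform.

(** * Convergence to the semicircle law *)

Section HookWeight.
Variable R : realType.
Local Notation e := (hook_weight R).

Lemma hook_weight_ge0 m : 0 <= e m.
Proof.
case: m => // m; rewrite /hook_weight; apply: prodr_ge0 => k _.
by rewrite divr_ge0.
Qed.

(** Total probability: every network has exactly one first location. *)
Lemma sum_hook_weight n : (2 <= n)%N ->
  \sum_(1 <= s < n) e s * e (n - s) = 'C(n, 2)%:R.
Proof.
move=> n2; have N0 : (0 < 'C(n, 2))%N by rewrite bin_gt0.
have c0 : (completions 'C(n, 2) (1 : 'S_n))%:R != 0 :> R.
  by rewrite pnatr_eq0 (completions_full_neq0 R).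
apply: (mulfI c0); rewrite mulr_sumr.
under eq_big_nat => s sn do rewrite -completions_ratio//.
rewrite -mulr_sumr -natr_sum mulrC; congr (_%:R * _).
rewrite -[in RHS](prednK N0) /=; apply: eq_bigr => s _; by rewrite mulg1.
Qed.

Lemma hook_weight_recr m : (0 < m)%N -> 2 * m%:R * e m.+1 = (2 * m%:R + 1) * e m.
Proof.
move=> m0; have m0' : m%:R != 0 :> R by rewrite pnatr_eq0 -lt0n.
rewrite hook_weightS// -muln2 -natr1 natrM; field; exact: m0'.
Qed.

Lemma hook_weight_bounds : exists2 K : R, 0 < K &
  forall m, (0 < m)%N -> K * (m%:R - 2^-1) <= e m ^+ 2 <= K * m%:R.
Proof.
pose a m : R := e m.+1 ^+ 2 / m.+1%:R; pose b m : R := e m.+1 ^+ 2 / (m.+1%:R - 2^-1).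
have step (m : nat) : [/\ 0 < m.+1%:R :> R, m.+2%:R = m.+1%:R + 1 :> R &
   e m.+2 ^+ 2 = (1 + (2 * m.+1%:R)^-1) ^+ 2 * e m.+1 ^+ 2].
  split; rewrite ?ltr0n// ?natr1//.
  have x0 : (m.+1)%:R != 0 :> R by rewrite pnatr_eq0.
  have -> : e m.+2 = (1 + (2 * m.+1%:R)^-1) * e m.+1.
    have x20 : 2 * m.+1%:R != 0 :> R by rewrite mulf_neq0.
    by apply: (mulfI x20); rewrite hook_weight_recr//; field.
  by rewrite exprMn.
have ai : {homo a : m n / (m <= n)%N >-> m <= n}.
  apply/nondecreasing_seqP => m; rewrite /a; have [x0 -> ->] := step m.
  move: (m.+1%:R) (e m.+1 ^+ 2) x0 (sqr_ge0 (e m.+1)) => x E x0 E0.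
  rewrite -subr_ge0 (_ : _ - _ = E / (4 * x ^+ 2 * (x + 1))); last first.
    by field; apply/andP; split; apply/lt0r_neq0; lra.
  by rewrite divr_ge0// mulr_ge0//; nra.
have bd : {homo b : m n / (m <= n)%N >-> n <= m}.
  apply/nonincreasing_seqP => m; rewrite /b; have [_ -> ->] := step m.
  have x0 : 1 <= m.+1%:R :> R by rewrite ler1n.
  move: (m.+1%:R) (e m.+1 ^+ 2) x0 (sqr_ge0 (e m.+1)) => x E x0 E0.
  rewrite -subr_ge0 (_ : _ - _ = E / (4 * x ^+ 2 * (x - 2^-1))); last first.
    by field; apply/and3P; split; apply/lt0r_neq0; lra.
  by rewrite divr_ge0// mulr_ge0//; nra.
have ab m : a m <= b m.
  have x1 : 1 <= m.+1%:R :> R by rewrite ler1n.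
  by rewrite /a /b ler_wpM2l ?sqr_ge0// lef_pV2 ?posrE; lra.
have amb m k : a m <= b k.
  have [mk|/ltnW km] := leqP m k; first exact: le_trans (ai _ _ mk) (ab k).
  exact: le_trans (ab m) (bd _ _ km).
have ub k : ubound (range a) (b k) by move=> _ [m _ <-].
have Kub : ubound (range a) (sup (range a)) by apply: ub_le_sup; exists (b 0%N).
(* Any K separating the values of [a] from those of [b] gives both bounds. *)
exists (sup (range a)).
  apply: (@lt_le_trans _ _ (a 0%N)); last by apply: Kub; exists 0%N.
  by rewrite /a hook_weight1; lra.
case=> // m _; apply/andP; split.
  have x1 : 1 <= m.+1%:R :> R by rewrite ler1n.
  have m0 : 0 < m.+1%:R - 2^-1 :> R by lra.
  by rewrite -ler_pdivlMr//; apply: ge_sup; [exists (a 0%N), 0%N|exact: (ub m)].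
by rewrite -ler_pdivrMr ?ltr0n//; apply: Kub; exists m.
Qed.

(** Subadditivity of the square root, checked by comparing squares. *)
Lemma sqrt_near (K X T D : R) : 0 < K -> 0 <= X -> 0 <= T -> 0 <= D ->
  K ^+ 2 * (T - D) <= X ^+ 2 <= K ^+ 2 * (T + D) ->
  `|X - K * Num.sqrt T| <= K * Num.sqrt D.
Proof.
move=> K0 X0 T0 D0 /andP[h1 h2]; rewrite ler_norml.
have := sqr_sqrtr T0; have := sqr_sqrtr D0.
have := sqrtr_ge0 T; have := sqrtr_ge0 D.
move: (Num.sqrt T) (Num.sqrt D) => t d d0 t0 dD tT.
rewrite -tT -dD in h1 h2.
have XKd : 0 <= X * (K * d) by rewrite !mulr_ge0// ltW.
have tKd : 0 <= (K * t) * (K * d) by rewrite !mulr_ge0// ltW.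
have Kd : 0 <= K * d by rewrite mulr_ge0// ltW.
have Kt : 0 <= K * t by rewrite mulr_ge0// ltW.
have h3 : K * t <= X + K * d.
  by rewrite -(@ler_pXn2r _ 2)// ?nnegrE; [lra|lra].
have h4 : X <= K * t + K * d.
  by rewrite -(@ler_pXn2r _ 2)// ?nnegrE; [lra|lra].
by apply/andP; split; lra.
Qed.

(* For y in the cell of s, the point t = n (y + 1) / 2 lies in (s - 1, s], and
   1 - y^2 = 4 t (n - t) / n^2. *)
Lemma hook_weight_semicircle (K : R) n s y : 0 < K ->
  (forall m, (0 < m)%N -> K * (m%:R - 2^-1) <= e m ^+ 2 <= K * m%:R) ->
  (0 < s <= n)%N -> rescale R n s.-1 < y <= rescale R n s ->
  `|e s * e (n - s) - K * (n%:R * pi / 4) * semicircle_pdf y|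
  <= K * Num.sqrt (2 * n%:R).
Proof.
move=> K0 Kb /andP[s0 sn] /andP[]; rewrite /rescale => y1 y2.
have n0 : 0 < n%:R :> R by rewrite ltr0n; lia.
have sE : s%:R = s.-1%:R + 1 :> R by rewrite natr1 prednK.
have snE : (n - s)%:R = n%:R - s%:R :> R by rewrite natrB.
have s10 : 0 <= s.-1%:R :> R by [].
have sn' : s%:R <= n%:R :> R by rewrite ler_nat.
pose t := n%:R * (y + 1) / 2.
have yE : y = 2 * t / n%:R - 1 by rewrite /t; field; apply/lt0r_neq0.
have ts : s.-1%:R < t.
  move: y1; rewrite yE; rewrite ltrD2r ltr_pM2r ?invr_gt0// ltr_pM2l//.
have tS : t <= s%:R.
  move: y2; rewrite yE; rewrite lerD2r ler_pM2r ?invr_gt0// ler_pM2l//.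
have pdfE : K * (n%:R * pi / 4) * semicircle_pdf y = K * Num.sqrt (t * (n%:R - t)).
  have pi0 : pi != 0 :> R by rewrite gt_eqF// pi_gt0.
  have -> : semicircle_pdf y = 2 / pi * Num.sqrt (1 - y ^+ 2).
    (* A cell may contain the endpoint y = 1, where the root vanishes as well. *)
    rewrite /semicircle_pdf; case: ifPn => //; rewrite negb_and -!leNgt => h.
    have -> : 1 - y ^+ 2 = 0.
      have y01 : -1 < y.
        by rewrite yE ltrDr; apply: divr_gt0 => //; lra.
      have y11 : y <= 1.
        by rewrite yE lerBlDr ler_pdivrMr//; lra.
      by case/orP: h => h; nra.
    by rewrite sqrtr0 mulr0.
  have -> : t * (n%:R - t) = (n%:R / 2) ^+ 2 * (1 - y ^+ 2) by rewrite /t; field.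
  rewrite sqrtrM ?sqr_ge0// sqrtr_sqr ger0_norm; last by rewrite divr_ge0// ltW.
  by move: (pi) pi0 => p p0; field.
have T0 : 0 <= t * (n%:R - t) by apply: mulr_ge0; lra.
(* Moving t by at most 1 to s changes t (n - t) by at most n, and the lower bounds on e_m^2 lose at
   most n / 2; the allowance 2 n covers both. *)
rewrite pdfE; apply: sqrt_near => //.
  by rewrite mulr_ge0// hook_weight_ge0.
clear pdfE yE y1 y2; move: ts tS T0; move: {y}t => t ts tS T0.
(* In the last cell s = n the bounds for positive m do not apply to e_0 = 0. *)
have [sn1|] := ltnP s n; last first.
  move=> ns; have -> : (n - s = 0)%N by lia.
  have sn'' : s%:R = n%:R :> R by congr _%:R; lia.
  rewrite /= mulr0 expr0n /=; apply/andP; split.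
    rewrite -oppr_ge0 -mulrN; apply: mulr_ge0; [exact: sqr_ge0|nra].
  apply: mulr_ge0; [exact: sqr_ge0|nra].
have /andP[a1 a2] := Kb s s0; have /andP[b1 b2] := Kb (n - s)%N ltac:(lia).
have sn1' : 1 <= (n - s)%:R :> R by rewrite ler1n subn_gt0.
have s1' : 1 <= s%:R :> R by rewrite ler1n.
rewrite exprMn; rewrite snE in b1 b2 sn1'.
apply/andP; split.
  apply: (@le_trans _ _ (K * (s%:R - 2^-1) * (K * (n%:R - s%:R - 2^-1)))); last first.
    by apply: ler_pM => //; apply: mulr_ge0; lra.
  rewrite [leRHS](_ : _ = K ^+ 2 * ((s%:R - 2^-1) * (n%:R - s%:R - 2^-1))); last by ring.
  rewrite ler_pM2l ?exprn_gt0//; nra.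
apply: (@le_trans _ _ (K * s%:R * (K * (n%:R - s%:R)))).
  by apply: ler_pM => //; exact: sqr_ge0.
rewrite [leLHS](_ : _ = K ^+ 2 * (s%:R * (n%:R - s%:R))); last by ring.
rewrite ler_pM2l ?exprn_gt0//; nra.
Qed.
End HookWeight.

(** * The distribution function of the semicircle law *)

Section SemicircleCdf.
Variables (R : realType) (d : measure_display) (T : measurableType d)
  (Q : probability T R) (Z : {RV Q >-> R}).
Hypothesis Zdensity : has_density Z (@semicircle_pdf R).
Local Notation pdf := (@semicircle_pdf R).

Lemma semicircle_pdf_ge0 (y : R) : 0 <= pdf y.
Proof.
rewrite /semicircle_pdf; case: ifP => // _.
by rewrite mulr_ge0 ?sqrtr_ge0// divr_ge0// pi_ge0.
Qed.

Lemma measurable_semicircle_pdf : measurable_fun setT pdf.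
Proof.
apply: measurable_fun_ifT => //.
  apply: (measurable_fun_bool true) => //; rewrite setTI.
  have -> : (fun y : R => -1 < y < 1) @^-1` [set true] = `]-1, 1[%classic.
    by apply/seteqP; split=> y /=; rewrite in_itv.
  exact: measurable_itv.
apply: measurable_funM => //.
apply: (measurableT_comp (f := @Num.sqrt R)).
  by apply: continuous_measurable_fun; exact: sqrt_continuous.
by apply: measurable_funB => //; exact: measurable_funX.
Qed.

Definition fine_cdf y := fine (cdf Z y).

Lemma cdf_fine y : cdf Z y = (fine_cdf y)%:E.
Proof. by rewrite fineK// fin_num_measure. Qed.

Lemma fine_cdf_itv a b : a <= b ->
  (fine_cdf b - fine_cdf a)%:E = (\int[lebesgue_measure]_(x in `]a, b]) (pdf x)%:E)%E.
Proof.
move=> ab; rewrite -Zdensity// EFinB -!cdf_fine /cdf.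
have -> : `]-oo, b]%classic = `]-oo, a]%classic `|` `]a, b]%classic :> set R.
  by rewrite -itv_bndbnd_setU.
rewrite measureU//; last first.
  apply/seteqP; split=> // x /=; rewrite !in_itv/= => -[h1 /andP[h2 _]].
  by move: (le_lt_trans h1 h2); rewrite ltxx.
rewrite addeAC subee ?add0e// fin_num_measure//.
Qed.

Lemma fine_cdf_itv_bounds a b l u : a <= b ->
  (forall y, a < y <= b -> l <= pdf y <= u) ->
  l * (b - a) <= fine_cdf b - fine_cdf a <= u * (b - a).
Proof.
move=> ab lu.
have mpdf : measurable_fun (`]a, b]%classic : set R) (EFin \o pdf).
  apply/measurable_EFinP; exact: measurable_funS measurable_semicircle_pdf.
have leb : (lebesgue_measure `]a, b] = (b - a)%:E :> \bar R)%E.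
  rewrite lebesgue_measure_itv/= lte_fin; case: ltgtP ab => // -> _.
  by rewrite subrr.
have ge c : 0 <= c ->
    (c * (b - a))%:E = (\int[lebesgue_measure]_(x in `]a, b]) (cst c%:E) x :> \bar R)%E.
  by move=> c0; rewrite integral_cst// EFinM -leb.
have [ba|ab'] := leP b a.
  have -> : b = a by apply/eqP; rewrite eq_le ab ba.
  by rewrite !subrr !mulr0 lexx.
have u0 : 0 <= u.
  have /andP[_] := lu b ltac:(by rewrite ab' lexx).
  exact/le_trans/semicircle_pdf_ge0.
apply/andP; split.
  (* The lower bound applied later may be negative, whereas monotonicity is used for nonnegative
     integrands. *)
  have [l0|l0] := leP 0 l.
    rewrite -lee_fin fine_cdf_itv// ge//; apply: ge0_le_integral => //.
    by move=> y /=; rewrite in_itv/= lee_fin => /lu /andP[].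
  apply: (@le_trans _ _ 0); first by rewrite nmulr_rle0// subr_ge0.
  rewrite -lee_fin fine_cdf_itv//; apply: integral_ge0 => y _.
  by rewrite lee_fin semicircle_pdf_ge0.
rewrite -lee_fin fine_cdf_itv// ge//; apply: ge0_le_integral => //.
  by move=> y _; rewrite lee_fin semicircle_pdf_ge0.
by move=> y /=; rewrite in_itv/= lee_fin => /lu /andP[].
Qed.

Lemma fine_cdf_leN1 y : y <= -1 -> fine_cdf y = 0.
Proof.
move=> y1; rewrite /fine_cdf /cdf Zdensity// integral0_eq// => x /=.
rewrite in_itv/= => xy; rewrite /semicircle_pdf ifF//.
by apply/negP => /andP[h _]; move: (le_trans xy y1); rewrite leNgt h.
Qed.

Lemma fine_cdf_ge1 y : 1 <= y -> fine_cdf y = 1.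
Proof.
move=> y1; apply: EFin_inj; rewrite -cdf_fine /cdf.
have /eqP := @probability_setT _ _ _ (distribution Q Z).
have -> : [set: R] = `]-oo, y]%classic `|` `]y, +oo[%classic.
  by rewrite itv_setU_setT.
rewrite measureU//; last first.
  apply/seteqP; split=> // x /=; rewrite !in_itv/= => -[h1 /andP[h2 _]].
  by move: (le_lt_trans h1 h2); rewrite ltxx.
rewrite [X in (_ + X)%E](_ : _ = 0%E) ?adde0; first by move/eqP.
rewrite [LHS](Zdensity (measurable_itv _)) integral0_eq// => x /=.
rewrite in_itv/= andbT => xy; rewrite /semicircle_pdf ifF//.
by apply/negP => /andP[_ h]; move: (lt_trans (le_lt_trans y1 xy) h); rewrite ltxx.
Qed.
End SemicircleCdf.

(** * Comparison of the law of s_1 with the semicircle law *)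

Section Approximation.
Variables (R : realType) (d : measure_display) (T : measurableType d)
  (Q : probability T R) (Z : {RV Q >-> R}).
Hypothesis Zdensity : has_density Z (@semicircle_pdf R).
Local Notation e := (hook_weight R).
Local Notation phi := (fine_cdf Z).

(** P(s_1 <= k); for k = n the additional term is 0 because e_0 = 0. *)
Definition first_swap_mass n k : R :=
  \sum_(1 <= s < k.+1) e s * e (n - s) / 'C(n, 2)%:R.

Lemma first_swap_mass_total n : (2 <= n)%N -> first_swap_mass n n = 1.
Proof.
move=> n2; have N0 : 'C(n, 2)%:R != 0 :> R by rewrite pnatr_eq0 -lt0n bin_gt0.
rewrite /first_swap_mass big_nat_recr/=; last lia.
by rewrite subnn mulr0 mul0r addr0 -mulr_suml sum_hook_weight// divff.
Qed.

Lemma first_swap_mass_ge0 n k : 0 <= first_swap_mass n k.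
Proof.
by apply: sumr_ge0 => s _; rewrite divr_ge0// mulr_ge0// hook_weight_ge0.
Qed.

Lemma first_swap_mass_le1 n k : (2 <= n)%N -> (k <= n)%N -> first_swap_mass n k <= 1.
Proof.
move=> n2 kn; rewrite -(first_swap_mass_total n2) /first_swap_mass.
rewrite [leRHS](@big_cat_nat _ _ _ k.+1)//= lerDl sumr_ge0// => s _.
by rewrite divr_ge0// mulr_ge0// hook_weight_ge0.
Qed.

Lemma cdf_first_swap_near n k : (2 <= n)%N -> (k <= n)%N ->
  `|phi (rescale R n k) - first_swap_mass n k| <= 16 * Num.sqrt (2 * n%:R) / (pi * n%:R).
Proof.
move=> n2 kn; have [K K0 Kb] := hook_weight_bounds R.
have n0 : 0 < n%:R :> R by rewrite ltr0n; lia.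
have p0 : 0 < pi :> R by exact: pi_gt0.
have N0 : 0 < 'C(n, 2)%:R :> R by rewrite ltr0n bin_gt0.
set D := Num.sqrt (2 * n%:R); set N := 'C(n, 2)%:R in N0.
(* [w] inverts the factor K n pi / 4 of [hook_weight_semicircle]; below, 2 / n is the width of a
   cell. *)
pose w : R := 4 / (K * n%:R * pi).
have w0 : 0 < w by rewrite /w; apply: divr_gt0 => //; rewrite !mulr_gt0.
pose c := w * 2 / n%:R * N; pose eta := w * K * D * 2 / n%:R.
have cell s : (0 < s <= n)%N ->
    `|phi (rescale R n s) - phi (rescale R n s.-1) - c * (e s * e (n - s) / N)| <= eta.
  move=> /andP[s0 sn]; set X := e s * e (n - s).
  have ba : rescale R n s - rescale R n s.-1 = 2 / n%:R.
    have -> : s = s.-1.+1 by lia.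
    by rewrite /rescale /= -natr1; field; apply/lt0r_neq0.
  have ab : rescale R n s.-1 <= rescale R n s.
    by rewrite -subr_ge0 ba divr_ge0// ltW.
  have lu y : rescale R n s.-1 < y <= rescale R n s ->
      w * (X - K * D) <= semicircle_pdf y <= w * (X + K * D).
    move=> ys; have := hook_weight_semicircle K0 Kb (s := s) (n := n) ltac:(by rewrite s0) ys.
    rewrite -/X -/D (_ : K * (n%:R * pi / 4) = w^-1); last first.
      rewrite /w; move: (pi) p0 => p p0; field.
      by apply/and3P; split; apply/lt0r_neq0.
    set f := semicircle_pdf y; rewrite ler_norml => /andP[h1 h2].
    have fE : f = w * (w^-1 * f) by rewrite mulVKf// lt0r_neq0.
    by rewrite fE !ler_pM2l//; apply/andP; split; lra.
  have := fine_cdf_itv_bounds Zdensity ab lu; rewrite ba => /andP[h1 h2].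
  have -> : c * (X / N) = w * X * (2 / n%:R).
    by rewrite /c; field; apply/andP; split; apply/lt0r_neq0.
  have etaE : eta = w * (K * D) * (2 / n%:R) by rewrite /eta !mulrA.
  rewrite ler_norml; apply/andP; split; rewrite etaE; lra.
have cum j : (j <= n)%N ->
    `|phi (rescale R n j) - c * first_swap_mass n j| <= j%:R * eta.
  elim: j => [|j IH] jn.
    rewrite /first_swap_mass big_geq// mulr0 subr0 mul0r.
    by rewrite (fine_cdf_leN1 Zdensity) ?normr0// /rescale mulr0 mul0r sub0r.
  have -> : first_swap_mass n j.+1 = first_swap_mass n j + e j.+1 * e (n - j.+1) / N.
    by rewrite /first_swap_mass big_nat_recr.
  have h1 := IH (ltnW jn); have h2 := cell j.+1 jn.
  rewrite (_ : _ - _ = (phi (rescale R n j) - c * first_swap_mass n j) +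
    (phi (rescale R n j.+1) - phi (rescale R n j) - c * (e j.+1 * e (n - j.+1) / N))); last by ring.
  rewrite -natr1 mulrDl mul1r; apply: le_trans (ler_normD _ _) _; exact: lerD.
have eta0 : 0 <= eta.
  have wKD : 0 <= w * K * D by apply: mulr_ge0 (sqrtr_ge0 _); exact/ltW/mulr_gt0.
  by apply: divr_ge0; [exact: mulr_ge0|exact: ltW].
have neta : n%:R * eta = 8 * D / (pi * n%:R).
  rewrite /eta /w; move: (pi) p0 => p p0; field.
  by apply/and3P; split; apply/lt0r_neq0.
(* At k = n both masses are 1, so the cumulative error bounds 1 - c. *)
have cn : `|1 - c| <= n%:R * eta.
  have := cum n (leqnn n); rewrite first_swap_mass_total// mulr1.
  rewrite (fine_cdf_ge1 Zdensity)//.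
  by rewrite /rescale mulfK ?lt0r_neq0//; lra.
have ck := cum k kn.
have m1 := first_swap_mass_le1 n2 kn; have m0 := first_swap_mass_ge0 n k.
rewrite (_ : _ - _ = (phi (rescale R n k) - c * first_swap_mass n k)
  - (1 - c) * first_swap_mass n k); last by ring.
apply: le_trans (ler_normB _ _) _.
(* The cumulative error and the error of c contribute 8 D / (pi n) each. *)
rewrite (_ : 16 * D / (pi * n%:R) = n%:R * eta + n%:R * eta * 1); last by rewrite neta; ring.
apply: lerD; first by apply: le_trans ck _; rewrite ler_wpM2r// ler_nat.
by rewrite normrM (ger0_norm m0) ler_pM.
Qed.

Lemma rescale_le n s (x : R) : (0 < n)%N ->
  (rescale R n s <= x) = (s%:R <= n%:R * (x + 1) / 2).
Proof.
move=> n0; have n0' : 0 < n%:R :> R by rewrite ltr0n.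
rewrite /rescale lerBlDr ler_pdivrMr// ler_pdivlMr// [2 * _]mulrC [n%:R * _]mulrC //.
Qed.

(** For x in [-1, 1) take k to be the integer part of n (x + 1) / 2. Beyond this interval k = 0 or k
    = n serves, as [phi] is constant there. *)
Lemma first_swap_mass_cdf n x : (2 <= n)%N -> exists k, [/\ (k <= n)%N,
  \sum_(1 <= s < n | rescale R n s <= x) e s * e (n - s) / 'C(n, 2)%:R = first_swap_mass n k &
  phi (rescale R n k) = phi x \/ `|rescale R n k - x| < 2 / n%:R].
Proof.
move=> n2; have n0 : (0 < n)%N by lia.
have n0' : 0 < n%:R :> R by rewrite ltr0n.
have r0 : rescale R n 0 = -1 by rewrite /rescale mulr0 mul0r sub0r.
have rn : rescale R n n = 1 by rewrite /rescale mulfK ?lt0r_neq0//; lra.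
have [x1|x1] := ltP x (-1).
  exists 0%N; split=> //; last by left; rewrite r0 !(fine_cdf_leN1 Zdensity)// ltW.
  rewrite /first_swap_mass [RHS]big_geq// big_pred0// => s.
  apply/negbTE; rewrite -ltNge; apply: lt_le_trans x1 _.
  by rewrite -r0 /rescale lerD2r ler_pM2r ?invr_gt0// ler_pM2l// ler_nat.
have [x2|x2] := leP 1 x.
  exists n; split=> //; last by left; rewrite rn !(fine_cdf_ge1 Zdensity).
  rewrite /first_swap_mass big_nat_recr//= subnn mulr0 mul0r addr0.
  rewrite big_nat_cond [RHS]big_nat_cond; apply: eq_bigl => s; rewrite andbT.
  case: (boolP (1 <= s < n)%N) => //= /andP[_ sn]; rewrite rescale_le//.
  apply: (@le_trans _ _ n%:R); first by rewrite ler_nat ltnW.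
  by rewrite ler_pdivlMr// ler_pM2l//; lra.
pose t := n%:R * (x + 1) / 2.
have t0 : 0 <= t by rewrite divr_ge0// mulr_ge0//; lra.
have tn : t < n%:R by rewrite /t ltr_pdivrMr// ltr_pM2l//; lra.
have /andP[kt tk] := truncn_itv t0.
set k := Num.truncn t in kt tk *.
have kn : (k < n)%N by rewrite -(ltr_nat R); apply: le_lt_trans tn.
exists k; split; first exact: ltnW.
  rewrite /first_swap_mass [RHS](big_nat_widen 1 k.+1 n)//.
  apply: eq_bigl => s; rewrite /= rescale_le// -/t ltnS.
  by rewrite truncn_ge_nat.
right; rewrite ltr_norml.
have -> : rescale R n k - x = (k%:R - t) * (2 / n%:R).
  by rewrite /rescale /t; field; apply/lt0r_neq0.
have n2' : 0 < 2 / n%:R :> R by rewrite divr_gt0.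
rewrite -natr1 in tk.
by apply/andP; split; nra.
Qed.

Lemma sqrt_over_near0 (eps : R) : 0 < eps ->
  \forall n \near \oo, 16 * Num.sqrt (2 * n%:R) / (pi * n%:R) < eps.
Proof.
move=> e0; near=> n.
have n0 : 0 < n%:R :> R by near: n; exact: nbhs_infty_gtr.
(* This gives sqrt(2 n) < eps n / 8, hence 16 sqrt(2 n) < 2 eps n <= eps pi n. *)
have nb : 128 / eps ^+ 2 < n%:R by near: n; exact: nbhs_infty_gtr.
have p0 : 0 < pi :> R by exact: pi_gt0.
rewrite ltr_pdivrMr ?mulr_gt0//.
have sq : Num.sqrt (2 * n%:R) < eps * n%:R / 8.
  have en : 0 <= eps * n%:R / 8 by rewrite divr_ge0// mulr_ge0// ltW.
  rewrite -(ger0_norm en) -sqrtr_sqr ltr_sqrt; last first.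
    by rewrite exprn_gt0// divr_gt0// mulr_gt0.
  rewrite ltr_pdivrMr ?exprn_gt0// in nb.
  have : 128 * n%:R < n%:R * eps ^+ 2 * n%:R by rewrite ltr_pM2r.
  rewrite expr_div_n exprMn; lra.
apply: (@lt_le_trans _ _ (16 * (eps * n%:R / 8))); first by rewrite ltr_pM2l.
rewrite (_ : 16 * _ = eps * (2 * n%:R)); last by field.
by rewrite ler_pM2l// ler_pM2r// pi_ge2.
Unshelve. all: by end_near. Qed.
End Approximation.

Theorem theorem1 (R : realType)
    (d : nat -> measure_display) (Omega : forall n, measurableType (d n))
    (P : forall n, probability (Omega n) R)
    (omega : forall n, {RV (P n) >-> 'C(n, 2).-tuple nat})
    (omega_uniform : forall n,
      uniformly_distributed (omega n) (sorting_networks n)) :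
  (forall n : nat, (2 <= n)%N ->
    equal_in_law (P := P n)
      (@omit_last 'C(n, 2) \o omega n) (@omit_first 'C(n, 2) \o omega n))
  /\
  (forall (dZ : measure_display) (OmegaZ : measurableType dZ)
      (Q : probability OmegaZ R) (Z : {RV Q >-> R}),
    has_density Z (@semicircle_pdf R) ->
    converges_in_distribution (P := P)
      (fun n => @rescale R n \o (@swap_location 'C(n, 2) 1 \o omega n)) Z).
Proof.
split=> [n n2|dZ OmegaZ Q Z Zdensity x xc]; first exact: omit_equal_in_law.
rewrite cdf_fine; apply/fine_cvgP; split.
  by near=> n; rewrite fin_num_measure.
have /fine_cvg phic : cdf Z y @[y --> x] --> (fine_cdf Z x)%:E.
  by rewrite -cdf_fine; exact: xc.
apply/cvgrPdist_lt => eps eps0; have eps20 : 0 < eps / 2 by rewrite divr_gt0.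
have /cvgrPdist_lt/(_ _ eps20)/nbhs_ballP[eta /= eta0 hphi] := phic.
have small_near := sqrt_over_near0 eps20.
near=> n.
have n2 : (2 <= n)%N by near: n; exact: nbhs_infty_ge.
have n0 : 0 < n%:R :> R by rewrite ltr0n; lia.
rewrite /= cdf_first_swap//=.
have [k [kn -> close]] := first_swap_mass_cdf Zdensity x n2.
have near_mass := cdf_first_swap_near Zdensity n2 kn.
have small : 16 * Num.sqrt (2 * n%:R) / (pi * n%:R) < eps / 2.
  by near: n; exact: small_near.
(* The grid point lies within 2 / n < eta of x, where continuity at x applies, unless the two values
   agree outright. *)
have h : `|fine_cdf Z x - fine_cdf Z (rescale R n k)| < eps / 2.
  case: close => [->|close]; first by rewrite subrr normr0.
  apply: hphi; rewrite /ball/= distrC; apply: (lt_trans close).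
  have : 2 / eta < n%:R by near: n; exact: nbhs_infty_gtr.
  by rewrite ltr_pdivrMr// ltr_pdivrMr// mulrC.
rewrite (_ : _ - _ = (fine_cdf Z x - fine_cdf Z (rescale R n k))
  + (fine_cdf Z (rescale R n k) - first_swap_mass R n k)); last by ring.
apply: le_lt_trans (ler_normD _ _) _.
by rewrite [eps]splitr; apply: ltr_leD => //; exact/ltW/(le_lt_trans near_mass).
Unshelve. all: by end_near. Qed.
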